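(* Fix $\varphi,\psi\in\mathfrak B$ such that $\varphi(z)\le\psi(z)$ for all $z\in[0,1]$. For each $n\ge1$, choose lattice paths $\Lambda_{\swarrow}^{(n)}$ and $\Lambda_{\nearrow}^{(n)}$ in $\boldsymbol\Lambda_n$ such that the former lies weakly southwest of the latter. Assume that $\theta_{\Lambda_{\swarrow}^{(n)}}$ and $\theta_{\Lambda_{\nearrow}^{(n)}}$ converge pointwise on $[0,1]$ to $\varphi$ and $\psi$, respectively. Let $v_n\in\mathfrak S_n$, and assume $(\pi_{v_n})_{n\ge1}$ converges weakly to a permuton $\mu$. Let $u_n=\tau_{\mathbf w(\mathscr S^{(n)})}(v_n)$, where $\mathscr S^{(n)}=\mathscr S(\Lambda_{\swarrow}^{(n)},\Lambda_{\nearrow}^{(n)})$. For each $(x,y)\in[0,1]^2$, we have $$\lim_{n\to\infty}\mathbf H_{u_n}(x,y)=\min_{0\le\gamma\le1}\left(\mathbf H_\mu(\gamma,y)+\mathsf h_1^{\varphi,\psi}(x,\gamma)\right)$$ with probability $1$. In particular, if $(v_n)_{n\ge1}$ is a sequence of independent permutations such that $v_n$ is chosen uniformly at random from $\mathfrak S_n$, then $$\lim_{n\to\infty}\mathbf H_{u_n}(x,y)=\min_{0\le\gamma\le1}\left((1-\gamma)y+\mathsf h_1^{\varphi,\psi}(x,\gamma)\right)$$ with probability $1$.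
   Context: Permutons. A permuton is a probability measure $\mu$ on $[0,1]^2$ with uniform marginals: $\mu([0,1]\times[a,b])=\mu([a,b]\times[0,1])=b-a$ for $0\le a\le b\le1$. Its height function is $\mathbf H_\mu(x,y)=\mu([x,1]\times[0,y])$. For a permutation $u$ in the symmetric group $\mathfrak S_n$, $\pi_u$ is the permuton with constant density $n$ on each of the squares $[\frac{i-1}{n},\frac in]\times[\frac{u(i)-1}{n},\frac{u(i)}{n}]$, $1\le i\le n$, and density $0$ elsewhere; $\mathbf H_u:=\mathbf H_{\pi_u}$. Operators. For $i\in\{1,\dots,n-1\}$, $\tau_i:\mathfrak S_n\to\mathfrak S_n$ puts the entries of $u$ in positions $i,i+1$ into decreasing order, leaving the rest unchanged: with $s_i=(i\;\,i+1)$, $\tau_i(u)=us_i$ if $u(i)<u(i+1)$ and $\tau_i(u)=u$ otherwise. For a word $\mathbf u=(i_1,\dots,i_r)$ over $\{1,\dots,n-1\}$, $\tau_{\mathbf u}=\tau_{i_r}\circ\cdots\circ\tau_{i_1}$. Shapes. For integers $x>y$, the box $\mathfrak b(x,y)$ is the axis-parallel unit square with lower-left vertex $(x,y)$; its content is $x-y$. A shape is a finite set of boxes, partially ordered by $\mathfrak b(x,y)\le\mathfrak b(x',y')$ iff $x\le x'$ and $y\le y'$. For a shape $\mathscr S$, listing its boxes according to a linear extension and recording their contents gives a word $\mathbf w(\mathscr S)$; different linear extensions give words differing only by swaps of adjacent letters whose values differ by at least $2$, so $\tau_{\mathbf w(\mathscr S)}$ is well defined. Let $\mathfrak L_a=\{(x,y)\in\mathbb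 R^2:x-y=a\}$. Let $\boldsymbol\Lambda_n$ be the set of lattice paths with unit east steps and unit south steps that start on $\mathfrak L_0$ and end on $\mathfrak L_n$. If $\Lambda_\swarrow,\Lambda_\nearrow\in\boldsymbol\Lambda_n$ and $\Lambda_\swarrow$ stays weakly southwest of $\Lambda_\nearrow$, then $\mathscr S(\Lambda_\swarrow,\Lambda_\nearrow)$ is the set of boxes contained in the region bounded by $\Lambda_\swarrow,\Lambda_\nearrow,\mathfrak L_0,\mathfrak L_n$ (its boxes have contents in $\{1,\dots,n-1\}$). Boundary functions. $\mathfrak B$ is the set of continuous, piecewise smooth functions $\theta:[0,1]\to\mathbb R$ whose derivative lies in $[0,1]$ wherever it exists. For $\Lambda\in\boldsymbol\Lambda_n$, $\theta_\Lambda\in\mathfrak B$ is the function such that the scaled path $\frac1n\Lambda$ is the curve $\{(\theta_\Lambda(z),\theta_\Lambda(z)-z):0\le z\le1\}$. For $\varphi\le\psi$ in $\mathfrak B$, $$\mathsf h_1^{\varphi,\psi}(x,y)=\min\big\{\max\{0,\;y-x,\;\psi(x)-\varphi(y)+y-x\},\;1-x,\;y\big\},\qquad (x,y)\in[0,1]^2.$$ *)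

(* Defs.v *)
From HB Require Import structures.
From mathcomp Require Import all_boot all_order all_algebra all_fingroup.
From mathcomp Require Import all_classical all_reals all_analysis.
From mathcomp Require Import ring lra zify.

Set Implicit Arguments.
Unset Strict Implicit.
Unset Printing Implicit Defensive.

Import Order.TTheory GRing.Theory Num.Theory.
Import numFieldNormedType.Exports.

Local Open Scope classical_set_scope.
Local Open Scope ring_scope.

(** * Permutons *)

Definition unit_square (R : realType) : set (R * R) := `[0, 1] `*` `[0, 1].
Arguments unit_square : clear implicits.

(* The plane with its Borel sigma-algebra, on which lebesgue_measure \x
   lebesgue_measure lives; the underlying type is R * R. *)
Notation plane R := (measurableTypeR R * measurableTypeR R)%type.

(* A measure on the square is represented by a measure on the plane: taking
   a = 0 and b = 1 below forces a permuton to be concentrated on the square. *)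
Definition is_permuton (R : realType) (mu : probability (plane R) R) : Prop :=
  forall a b : R, 0 <= a -> a <= b -> b <= 1 ->
    mu (`[0, 1] `*` `[a, b]) = (b - a)%:E /\
    mu (`[a, b] `*` `[0, 1]) = (b - a)%:E.

Definition permuton_height (R : realType) (mu : {measure set (plane R) -> \bar R})
  (x y : R) : R := fine (mu (`[x, 1] `*` `[0, y])).

(* The support of pi_u.  Positions and values are 0-based: i : 'I_n stands for
   the position i.+1 of the informal convention, and u i for the value
   (u i).+1. *)
Definition perm_squares (R : realType) n (u : 'S_n) : set (R * R) :=
  \bigcup_(i : 'I_n)
    (`[i%:R / n%:R, i.+1%:R / n%:R] `*` `[(u i)%:R / n%:R, (u i).+1%:R / n%:R]).
Arguments perm_squares R {n} u.

Lemma measurable_perm_squares (R : realType) n (u : 'S_n) :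
  measurable (perm_squares R u).
Proof.
apply: fin_bigcup_measurable; first exact: finite_finset.
by move=> i _; apply: measurableX; exact: measurable_itv.
Qed.

Definition perm_permuton (R : realType) n (u : 'S_n) :
    {measure set (plane R) -> \bar R} :=
  mscale (n%:R)%:nng
    (mrestr (lebesgue_measure \x lebesgue_measure)%E
      (@measurable_perm_squares R n u)).

(* Continuous functions on the square are bounded, so that these are all the
   test functions of weak convergence on the square. *)
Definition weakly_converges (R : realType)
    (nu : nat -> {measure set (plane R) -> \bar R})
    (mu : {measure set (plane R) -> \bar R}) : Prop :=
  forall f : R * R -> R, {within unit_square R, continuous f} ->
    (fun n => \int[nu n]_(p in unit_square R) f p) @ \oo -->
    \int[mu]_(p in unit_square R) f p.

(** * Operators on permutations *)

(* The letter i >= 1 acts on the 0-based positions i.-1 and i, and letters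
   outside 1, ..., n.-1 act trivially.  In MathComp (s * t) x = t (s x), so
   that tperm a b * u is the permutation usually written u (a b). *)
Definition tau n (u : 'S_n) (i : nat) : 'S_n :=
  if (insub i.-1, insub i) is (Some a, Some b)
  then if (u a < u b)%N then (tperm a b * u)%g else u
  else u.

Definition tau_word n (w : seq nat) (u : 'S_n) : 'S_n := foldl (@tau n) u w.

(** * Shapes *)

(* (x, y) stands for the unit square with lower-left vertex (x, y), x > y. *)
Definition box := (int * int)%type.

Definition box_region (R : realType) (b : box) : set (R * R) :=
  `[b.1%:~R, (b.1 + 1)%:~R] `*` `[b.2%:~R, (b.2 + 1)%:~R].
Arguments box_region : clear implicits.

Definition box_content (b : box) : nat := absz (b.1 - b.2).

Definition box_le (b c : box) : bool := (b.1 <= c.1) && (b.2 <= c.2).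

Definition linear_extension (S : set box) (s : seq box) : Prop :=
  [/\ uniq s, [set` s] = S &
      {in s &, forall b c, box_le b c -> (index b s <= index c s)%N}].

(* The paths in Lambda_n: they start at (lp_start, lp_start), and their k-th
   step is east if the k-th bit is true and south otherwise.  Each step raises
   x - y by 1, so ending on L_n means having n steps. *)
Record lattice_path n := LatticePath {
  lp_start : int;
  lp_east : n.-tuple bool
}.

Definition lp_vertex n (L : lattice_path n) (k : nat) : int * int :=
  (lp_start L + (count id (take k (lp_east L)))%:Z,
   lp_start L - (count negb (take k (lp_east L)))%:Z).

(* For 0 <= t <= n, the abscissa of the point at which the path meets the line
   x - y = t, by linear interpolation between consecutive vertices. *)
Definition path_x (R : realType) n (L : lattice_path n) (t : R) : R :=
  let k := Num.truncn t in
  (lp_vertex L k).1%:~R +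
  (t - k%:R) * ((lp_vertex L k.+1).1 - (lp_vertex L k).1)%:~R.

Definition path_theta (R : realType) n (L : lattice_path n) (z : R) : R :=
  path_x L (n%:R * z) / n%:R.

Definition weakly_southwest (R : realType) n (L M : lattice_path n) : Prop :=
  forall t : R, 0 <= t <= n%:R -> path_x L t <= path_x M t.

Definition region_between (R : realType) n (L M : lattice_path n) :
    set (R * R) :=
  [set p | 0 <= p.1 - p.2 <= n%:R /\
           path_x L (p.1 - p.2) <= p.1 <= path_x M (p.1 - p.2)].
Arguments region_between R {n} L M.

Definition shape_between (R : realType) n (L M : lattice_path n) : set box :=
  [set b | b.2 < b.1 /\ box_region R b `<=` region_between R L M].
Arguments shape_between R {n} L M.

Lemma path_x_bounds (R : realType) n (L : lattice_path n) (t : R) : 0 <= t ->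
  (lp_start L)%:~R <= path_x L t <= (lp_start L + n%:Z)%:~R.
Proof.
move=> t0; rewrite /path_x /=; set k := Num.truncn t; set e := tval _.
have /andP[kt tk] : k%:R <= t < k.+1%:R by rewrite /k Num.Theory.truncn_itv.
have cn j : (count id (take j e) <= n)%N.
  apply: leq_trans (count_size _ _) _; rewrite size_take_min.
  by rewrite (size_tuple (lp_east L)) geq_minr.
have ck : (count id (take k e) <= count id (take k.+1 e))%N.
  have [ke|ke] := ltnP k (size e).
    by rewrite (take_nth false ke) -cats1 count_cat leq_addr.
  by rewrite !take_oversize // ltnW.
have cn' := cn k.+1; rewrite /lp_vertex /= -/e.
move: ck cn'; set c := count _ _; set c' := count _ _ => ck cn'.
have -> : lp_start L + c'%:Z - (lp_start L + c%:Z) = c'%:Z - c%:Z by ring.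
rewrite intrD intrB intrD -!pmulrn.
move: tk; rewrite -natr1 => tk.
have h1 : c%:R <= c'%:R :> R by rewrite ler_nat.
have h2 : c'%:R <= n%:R :> R by rewrite ler_nat.
have h3 : 0 <= c%:R :> R by [].
move: (c%:R) (c'%:R) (k%:R) h1 h2 h3 kt tk ((lp_start L)%:~R) => C C' K *.
by apply/andP; split; nra.
Qed.

Lemma linear_extension_exists (R : realType) n (L M : lattice_path n) :
  exists s, linear_extension (shape_between R L M) s.
Proof.
set S := shape_between R L M.
have [A [N SAN]] : exists (A : int) (N : nat), forall b, S b ->
    exists i j : nat, [/\ (i < N)%N, (j < N)%N & b = (A + i%:Z, A + j%:Z)].
  exists (lp_start L - n%:Z), (`|(lp_start M + n%:Z - (lp_start L - n%:Z))%R|%N).+1.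
  move=> [x y] [/= yx] /(_ (x%:~R, y%:~R)) /=.
  rewrite /box_region /region_between /= !in_itv /= !lexx !ler_int !lerDl.
  move=> /(_ (conj isT isT)) [/andP[c0 cn] /andP[Lx xM]].
  have /andP[La _] := path_x_bounds L c0.
  have /andP[_ Mb] := path_x_bounds M c0.
  have := le_trans La Lx; have := le_trans xM Mb; rewrite !ler_int => xu xl.
  move: cn; rewrite -intrB pmulrn ler_int => cn.
  exists `|(x - (lp_start L - n%:Z))%R|%N, `|(y - (lp_start L - n%:Z))%R|%N.
  by split; [lia|lia|congr pair; lia].
pose grid := [seq (A + i%:Z, A + j%:Z) | i <- iota 0 N, j <- iota 0 N].
pose leT (b c : box) := b.1 + b.2 <= c.1 + c.2.
have leT_total : total leT by move=> b c; exact: le_total.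
have leT_trans : transitive leT by move=> b c d'; exact: le_trans.
pose s := sort leT (undup [seq b <- grid | `[< S b >]]).
have us : uniq s by rewrite sort_uniq undup_uniq.
exists s; split => //.
  apply/seteqP; split => b /=; rewrite /s mem_sort mem_undup mem_filter.
    by case/andP => /asboolP.
  move=> Sb; apply/andP; split; first exact/asboolP.
  have [i [j [iN jN ->]]] := SAN _ Sb.
  by apply: allpairs_f; rewrite mem_iota.
move=> b c bs cs /andP[bc1 bc2]; rewrite leqNgt; apply/negP => ltcb.
have := sorted_ltn_index leT_trans (sort_sorted leT_total _) _ _ cs bs ltcb.
rewrite /leT => cb; have E : b = c.
  by move: b c bc1 bc2 cb {bs cs ltcb} => [x y] [x' y'] /= *; congr pair; lia.
by move: ltcb; rewrite E ltnn.
Qed.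

(** * Boundary functions *)

(* Functions on [0, 1] are represented by functions on R, whose values outside
   of [0, 1] are irrelevant. *)
Definition piecewise_smooth (R : realType) (f : R -> R) : Prop :=
  exists s : seq R, forall x : R, x \in `]0, 1[ -> x \notin s ->
    forall k, derivable (derive1n k f) x 1.

Definition boundary_function (R : realType) (f : R -> R) : Prop :=
  [/\ {within `[0, 1], continuous f}, piecewise_smooth f &
      forall x : R, x \in `]0, 1[ -> derivable f x 1 -> 0 <= derive1 f x <= 1].

Definition h1 (R : realType) (phi psi : R -> R) (x y : R) : R :=
  Num.min
    (Num.max 0 (Num.max (y - x) (psi x - phi y + y - x)))
    (Num.min (1 - x) y).

Definition is_min_on_unit (R : realType) (F : R -> R) (m : R) : Prop :=
  (exists2 g : R, g \in `[0, 1] & F g = m) /\ (forall g : R, g \in `[0, 1] -> m <= F g).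

(** * Random permutations *)

Section random_permutations.
Context d (Omega : measurableType d) (R : realType) (P : probability Omega R).
Variable v : forall n, Omega -> 'S_n.

Definition random_permutations : Prop :=
  forall n (s : 'S_n), measurable [set w | v n w = s].

Definition mutually_independent : Prop :=
  forall (J : seq nat) (A : forall n, set 'S_n), uniq J ->
    P (\bigcap_(n in [set` J]) (v n @^-1` A n)) =
    (\prod_(n <- J) P (v n @^-1` A n))%E.

Definition uniformly_distributed : Prop :=
  forall n (s : 'S_n), P [set w | v n w = s] = (n`!%:R^-1)%:E.

End random_permutations.

(* Main.v *)
(** Let [rk u i j] count the positions [k >= i] (0-based) with [u k < j], so that
    [n H_u(x, y)] is [rk u (n x) (n y)] up to a bounded error.  Applying [tau_c]
    replaces [rk u c j] by [min (rk u (c - 1) j, rk u (c + 1) j + 1)] and keeps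
    the other rows: the operators are linear over the min-plus semiring.  Adding
    the boxes of the shape one at a time moves a lattice path from the southwest
    to the northeast boundary, and by induction the row [i] of the current
    permutation is
      [min {j, n - i, min_a (rk v a j + max {0, a - i, X i - X_sw a + a - i})}]
    where [X i] is the abscissa of the current path at content [i].  For the whole
    shape this is an exact discrete version of the variational formula; both terms
    are Lipschitz in [a / n], so pointwise convergence of the height functions of
    [v_n] suffices to pass to the limit in the minimum.  Weak convergence gives
    pointwise convergence by sandwiching indicators of rectangles between
    continuous ramps.  For uniform permutations it follows from Borel-Cantelli
    and the Chernoff bound for the hypergeometric law of [rk]: sampling without
    replacement has a smaller moment generating function than with replacement. *)

Require Import Defs.
From mathcomp Require Import all_boot all_order all_algebra all_fingroup.
From mathcomp Require Import all_classical all_reals all_analysis.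
From mathcomp Require Import measurable_realfun ring lra zify.

Set Implicit Arguments.
Unset Strict Implicit.
Unset Printing Implicit Defensive.

Import Order.TTheory GRing.Theory Num.Theory.
Import numFieldNormedType.Exports.

Local Open Scope classical_set_scope.
Local Open Scope ring_scope.

(** * The operators on rank functions *)

Definition rk n (u : 'S_n) (i j : nat) : nat :=
  (\sum_(k < n) ((i <= k) && (u k < j)))%N.

Lemma rk_oversize n (u : 'S_n) i j : (n <= i)%N -> rk u i j = 0%N.
Proof.
move=> ni; rewrite /rk big1 // => k _.
by rewrite leqNgt (leq_trans (ltn_ord k) ni).
Qed.

Lemma rkS n (u : 'S_n) (i : 'I_n) j : rk u i j = ((u i < j) + rk u i.+1 j)%N.
Proof.
rewrite /rk (bigD1 i) //= [in RHS](bigD1 i) //= leqnn ltnn /= add0n.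
congr addn; apply: eq_bigr => k ki.
by rewrite [in RHS]ltn_neqAle eq_sym ki.
Qed.

Lemma rk0 n (u : 'S_n) j : (j <= n)%N -> rk u 0 j = j.
Proof.
move=> jn; transitivity (\sum_(k < n) (k < j))%N.
  by rewrite [RHS](reindex_inj (@perm_inj _ u)).
transitivity (\sum_(k < j) 1)%N; last by rewrite sum1_card card_ord.
rewrite (big_ord_widen n (fun=> 1%N) jn) [RHS]big_mkcond.
by apply: eq_bigr => k _; case: ltnP.
Qed.

Lemma rk_le_succ n (u : 'S_n) i j : (rk u i.+1 j <= rk u i j <= (rk u i.+1 j).+1)%N.
Proof.
have [ni|ni] := leqP n i; first by rewrite !rk_oversize // ltnW.
by rewrite (rkS u (Ordinal ni)) /=; case: (_ < j)%N; rewrite ?leqnn ?leqnSn.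
Qed.

Lemma rk_homo n (u : 'S_n) i i' j : (i <= i')%N -> (rk u i' j <= rk u i j <= rk u i' j + (i' - i))%N.
Proof.
move=> /subnKC <-; elim: (i' - i)%N => [|k IH]; first by rewrite addn0; lia.
by have := rk_le_succ u (i + k) j; rewrite addnS; lia.
Qed.

Lemma rk_le_succr n (u : 'S_n) i j : (rk u i j <= rk u i j.+1 <= (rk u i j).+1)%N.
Proof.
apply/andP; split.
  by apply: leq_sum => k _; lia.
have [jn|jn] := ltnP j n; last first.
  apply/leqW/eq_leq; rewrite /rk; apply eq_bigr => k _; congr nat_of_bool.
  by have := ltn_ord (u k); lia.
(* Passing from [j] to [j.+1] admits only the value [j], which sits at the single position [k0]. *)
pose k0 := (u^-1)%g (Ordinal jn).
rewrite /rk (bigD1 k0) //= [X in (_ <= X.+1)%N](bigD1 k0) //= permKV /= ltnn andbF add0n.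
rewrite -[X in (_ <= X)%N]add1n leq_add ?leq_b1 //; apply/eq_leq; apply: eq_bigr => k kk0; congr nat_of_bool.
rewrite ltnS [(u k <= j)%N]leq_eqVlt.
suff -> : (u k == j :> nat) = false by [].
apply/negP => /eqP e; case/eqP: kk0; apply: (@perm_inj _ u).
by apply: val_inj; rewrite /= permKV.
Qed.

(** Only row [c] separates the two positions touched by [tau]. Afterwards position [c] holds the
    smaller of the two entries, so row [c] exceeds row [c.+1] by one exactly when at least one of
    them is below [j], that is, when row [c.-1] exceeds row [c.+1]. *)
Lemma rk_tau n (u : 'S_n) c i j : (0 < c < n)%N ->
  rk (tau u c) i j = if i == c then minn (rk u c.-1 j) (rk u c.+1 j).+1 else rk u i j.
Proof.
case/andP => c0 cn; have cn1 : (c.-1 < n)%N by lia.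
pose a := Ordinal cn1; pose b := Ordinal cn.
have ac : a.+1 = c by rewrite /= prednK.
have tE : tau u c = if (u a < u b)%N then (tperm a b * u)%g else u.
  by rewrite /tau (insubT (fun k => k < n)%N cn1) (insubT (fun k => k < n)%N cn).
have tne i' : i' != c -> rk (tau u c) i' j = rk u i' j.
  move=> ic; rewrite tE; case: ifP => // _.
  rewrite /rk [RHS](reindex_inj (@perm_inj _ (tperm a b))) /=.
  apply: eq_bigr => k _; rewrite permM; congr (nat_of_bool (_ && _)).
  case: tpermP => //= [->|->] /=; lia.
case: eqVneq => [->|]; last exact: tne.
rewrite (rkS _ b) tne /=; last by lia.
rewrite (rkS u a) ac (rkS u b) /= tE.
case: ifP => ab; rewrite ?permM ?tpermR; lia.
Qed.

(* Spells out h = min {j, n - i, min_a (h0 a + max {0, a - i, X - xs a + a - i})}. *)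
Definition passage n (h0 : nat -> nat) (xs : nat -> int) (j i : nat) (X : int)
    (h : nat) : Prop :=
  [/\ (h <= j)%N, (h <= n - i)%N,
    forall a, (a <= n)%N ->
      h%:Z <= (h0 a)%:Z + Num.max 0 (Num.max (a%:Z - i%:Z) (X - xs a + a%:Z - i%:Z)) &
    [\/ h = j, h = (n - i)%N |
      exists2 a, (a <= n)%N &
        h%:Z = (h0 a)%:Z + Num.max 0 (Num.max (a%:Z - i%:Z) (X - xs a + a%:Z - i%:Z))]].

(* Both formulas agree term by term: the only delicate term is a = c, where
   xs c <= x makes the last entry of the maximum positive. *)
Lemma passage_step n h0 xs j c (x : int) p q : (0 < c < n)%N ->
  xs c <= x ->
  passage n h0 xs j c.-1 x p -> passage n h0 xs j c.+1 (x + 1) q ->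
  passage n h0 xs j c (x + 1) (minn p q.+1).
Proof.
move=> cn xc [pj pn pa pe] [qj qn qa qe]; split; [lia|lia| |].
  move=> a an; have := pa a an; have := qa a an.
  have [->|ac] := eqVneq a c; lia.
have [pq|qp] := leqP p q.+1.
  case: pe => [->|e|[a an e]]; [by constructor 1|by constructor 2; lia|].
  constructor 3; exists a => //.
  have := pa a an; have := qa a an.
  have [ea|ac] := eqVneq a c; last by lia.
  by subst a; lia.
case: qe => [e|e|[a an e]]; [lia|by constructor 2; lia|].
constructor 3; exists a => //.
have := pa a an; have := qa a an.
have [ea|ac] := eqVneq a c; last by lia.
by subst a; lia.
Qed.

Definition unit_steps n (xs : nat -> int) : Prop :=
  forall k, (k < n)%N -> xs k <= xs k.+1 <= xs k + 1.

Lemma unit_steps_homo n xs i a : unit_steps n xs -> (i <= a <= n)%N ->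
  xs i <= xs a <= xs i + (a - i)%N%:Z.
Proof.
move=> st /andP[/subnKC <-]; elim: (a - i)%N => [|k IH] kn.
  by rewrite addn0 subnn; lia.
have := IH ltac:(lia); have := st (i + k)%N ltac:(lia).
by rewrite addnS; lia.
Qed.

(** Base case, with the path still on the southwest boundary. The term [a = i] attains the minimum;
    the others are no smaller, since row [a] is at least row [i] for [a <= i] and at most [a - i]
    below it for [a >= i]. *)
Lemma passage_init n (v : 'S_n) xs j i : unit_steps n xs -> (i <= n)%N ->
  (j <= n)%N -> passage n (rk v ^~ j) xs j i (xs i) (rk v i j).
Proof.
move=> st i_n jn; split.
- by have := rk_homo v j (leq0n i); rewrite rk0 //; lia.
- by have := rk_homo v j i_n; rewrite rk_oversize //; lia.
- move=> a an; have [ia|/ltnW ai] := leqP i a.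
    by have := rk_homo v j ia; lia.
  by have := rk_homo v j ai; lia.
- by constructor 3; exists i => //; lia.
Qed.

(** Rows [0] and [n] are constant and attain the caps [j] and [n - i], whatever the abscissa [X]. A
    box of content [1] or [n - 1] can thus be treated like any other, with no condition on the path
    at the outer neighbour. *)
Lemma passage_first n (v : 'S_n) xs j X : (j <= n)%N ->
  passage n (rk v ^~ j) xs j 0 X j.
Proof.
move=> jn; split; [lia|lia| |by constructor 1].
by move=> a an; have := rk_homo v j (leq0n a); rewrite rk0 //; lia.
Qed.

Lemma passage_last n h0 xs j X : passage n h0 xs j n X 0.
Proof. by split; [lia|lia|lia|constructor 2; lia]. Qed.

(** Induction on the number of boxes added. The shape is described by its diagonals: the boxes of
    content [i] have abscissas from [xs i] up to [xn i - 1]. *)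
Lemma rk_tau_word n (v : 'S_n) j (xs xn : nat -> int) (s : seq box) :
  (j <= n)%N -> unit_steps n xs -> unit_steps n xn ->
  (forall i : nat, (0 < i < n)%N -> xs i <= xn i) -> uniq s ->
  (forall b, b \in s -> b.2 < b.1 /\ (0 < box_content b < n)%N) ->
  (forall (i : nat) (x : int), (0 < i < n)%N -> ((x, x - i%:Z) \in s) = (xs i <= x < xn i)) ->
  {in s &, forall b c, box_le b c -> (index b s <= index c s)%N} ->
  forall i, (i <= n)%N ->
    passage n (rk v ^~ j) xs j i (xn i) (rk (tau_word (map box_content s) v) i j).
Proof.
move=> jn sts stn sn us sc smem sle.
have rk_0 (w : 'S_n) : rk w 0 j = j by exact: rk0.
have rk_n (w : 'S_n) : rk w n j = 0%N by exact: rk_oversize.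
(* [X] is the current path: among the boxes of content [i], those already added are the ones with
   abscissa less than [X i]. *)
have [X [pX bX iX]] : exists X : nat -> int, [/\
    forall i, (i <= n)%N -> passage n (rk v ^~ j) xs j i (X i)
      (rk (tau_word (map box_content (take (size s) s)) v) i j),
    forall i, (0 < i < n)%N -> xs i <= X i <= xn i &
    forall (i : nat) (x : int), (0 < i < n)%N -> xs i <= x < xn i ->
      (index (x, x - i%:Z)%R s < size s)%N = (x < X i)].
  elim: {-2}(size s) (leqnn (size s)) => [|k IH] ks.
    exists xs; split; first by move=> i i_n; rewrite take0; exact: passage_init.
      by move=> i i_n; rewrite lexx sn.
    by move=> i x _ /andP[h _]; rewrite ltn0 ltNge h.
  have [X [pX bX iX]] := IH (ltnW ks).
  pose b : box := nth (0, 0) s k; pose c := box_content b; pose x : int := b.1.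
  have bs : b \in s by rewrite mem_nth.
  have bE : b = (x, x - c%:Z).
    have [] := sc b bs; rewrite /c /x /box_content; case: (b) => /= p q *.
    by congr pair; lia.
  have ib : index b s = k by rewrite index_uniq.
  have ibP b' : b' \in s -> index b' s = k -> b' = b.
    by move=> b's e; rewrite /b -e nth_index.
  have ibQ b' : b' \in s -> (index b' s <= k)%N -> (index b' s < k)%N = false -> b' = b.
    by move=> b's b'k /negbT b'k'; apply: ibP => //; apply/eqP; rewrite eqn_leq b'k leqNgt.
  have [_ cn] := sc b bs; rewrite -/c in cn.
  have bN : nth (0, 0) s k = b by [].
  have cE : box_content b = c by [].
  clearbody c x b.
  have xP : xs c <= x < xn c by rewrite -smem // -bE.
  (* The next box [b] is the first missing one on its diagonal: a missing box further down the
     diagonal would precede [b] in the linear extension. *)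
  have Xc : X c = x.
    have := iX c x cn xP; rewrite -bE ib ltnn => /esym/negbT; rewrite -leNgt => h.
    have [h'|//] : X c < x \/ X c = x by lia.
    have h2 : xs c <= X c < xn c by have := bX c cn; lia.
    have := iX c (X c) cn h2; rewrite ltxx => h3.
    have b's : (X c, X c - c%:Z) \in s by rewrite smem.
    have := sle _ _ b's bs; rewrite {1}bE ib /box_le /= => /(_ ltac:(lia)) h4.
    have := ibQ _ b's h4 h3; rewrite bE => -[]; lia.
  (* The path must go south, then east around the lower-left vertex of [b]. If [X c.-1] were
     smaller, a missing box of content [c.-1] would lie below [b] in the order; if larger, the box
     directly above [b] would have been added before [b]. *)
  have Xl : (0 < c.-1)%N -> X c.-1 = x.
    move=> c1; have c1n : (0 < c.-1 < n)%N by lia.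
    have := sts c.-1 ltac:(lia); have := stn c.-1 ltac:(lia); rewrite prednK; last lia.
    move=> hn hs; have hb := bX _ c1n.
    have [h|[//|h]] : X c.-1 < x \/ X c.-1 = x \/ x < X c.-1 by lia.
      have h2 : xs c.-1 <= X c.-1 < xn c.-1 by lia.
      have := iX _ (X c.-1) c1n h2; rewrite ltxx => h3.
      have b's : (X c.-1, X c.-1 - (c.-1)%:Z) \in s by rewrite smem.
      have := sle _ _ b's bs; rewrite {1}bE ib /box_le /= => /(_ ltac:(lia)) h4.
      have := ibQ _ b's h4 h3; rewrite bE => -[]; lia.
    have h2 : xs c.-1 <= x < xn c.-1 by lia.
    have := iX _ x c1n h2; rewrite h => h3.
    have b's : (x, x - (c.-1)%:Z) \in s by rewrite smem.
    have := sle _ _ bs b's; rewrite {1}bE ib /box_le /= => /(_ ltac:(lia)).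
    by rewrite leqNgt h3.
  (* The same argument on the other side, with the box directly to the right of [b]. *)
  have Xr : (c.+1 < n)%N -> X c.+1 = x + 1.
    move=> c1; have c1n : (0 < c.+1 < n)%N by lia.
    have := sts c ltac:(lia); have := stn c ltac:(lia).
    move=> hn hs; have hb := bX _ c1n.
    have [h|[//|h]] : X c.+1 < x + 1 \/ X c.+1 = x + 1 \/ x + 1 < X c.+1 by lia.
      have h2 : xs c.+1 <= X c.+1 < xn c.+1 by lia.
      have := iX _ (X c.+1) c1n h2; rewrite ltxx => h3.
      have b's : (X c.+1, X c.+1 - (c.+1)%:Z) \in s by rewrite smem.
      have := sle _ _ b's bs; rewrite {1}bE ib /box_le /= => /(_ ltac:(lia)) h4.
      have := ibQ _ b's h4 h3; rewrite bE => -[]; lia.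
    have h2 : xs c.+1 <= x + 1 < xn c.+1 by lia.
    have := iX _ (x + 1) c1n h2; rewrite h => h3.
    have b's : (x + 1, x + 1 - (c.+1)%:Z) \in s by rewrite smem.
    have := sle _ _ bs b's; rewrite {1}bE ib /box_le /= => /(_ ltac:(lia)).
    by rewrite leqNgt h3.
  (* Adding [b] replaces a south-east corner by an east-south one: only the vertex at content [c]
     moves, and its abscissa grows by one. *)
  exists (fun i => if i == c then x + 1 else X i); split.
  - move=> i i_n; rewrite (take_nth (0, 0) ks) map_rcons -cats1 /tau_word foldl_cat /=.
    rewrite -/(tau_word _ v) bN cE rk_tau //; case: eqVneq => [->|_]; last exact: pX.
    apply: passage_step => //; first by move: xP => /andP[].
      have [c1|c1] := posnP c.-1; first by rewrite c1 rk_0; exact: passage_first.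
      by rewrite -Xl //; apply: pX; lia.
    have [c1|c1] := ltnP c.+1 n; first by rewrite -Xr //; apply: pX; lia.
    have -> : c.+1 = n by lia.
    by rewrite rk_n; exact: passage_last.
  - by move=> i i_n; case: eqVneq => [->|_]; [lia|exact: bX].
  - move=> i z i_n zP; have zs : (z, z - i%:Z) \in s by rewrite smem.
    have := iX i z i_n zP; have := ibP _ zs.
    case: eqVneq => [ic|ic].
      subst i; rewrite Xc; have [->|zx] := eqVneq z x.
        by rewrite -bE ib; lia.
      move=> h e; have : index (z, z - c%:Z)%R s != k.
        by apply/negP => /eqP/h; rewrite bE => -[]; lia.
      lia.
    move=> h e; have : index (z, z - i%:Z)%R s != k.
      by apply/negP => /eqP/h; rewrite bE => -[]; lia.
    lia.
move=> i i_n; have := pX i i_n; rewrite take_size.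
have [i0|i0] := posnP i; first by rewrite i0 rk_0 => _; exact: passage_first.
have [ein|ein] := eqVneq i n.
  by rewrite ein rk_n => _; exact: passage_last.
have i1 : (0 < i < n)%N by lia.
(* Once every box has been added the path is the northeast boundary; otherwise the box of content
   [i] at abscissa [X i] would still be missing. *)
suff -> : X i = xn i by [].
have := bX i i1 => hb; have [h|//] : X i < xn i \/ X i = xn i by lia.
have h2 : xs i <= X i < xn i by lia.
have := iX i _ i1 h2; rewrite ltxx index_mem smem // h2; lia.
Qed.

(** * The boxes between two lattice paths *)

Lemma lp_vertex_step n (L : lattice_path n) k :
  (lp_vertex L k).1 <= (lp_vertex L k.+1).1 <= (lp_vertex L k).1 + 1.
Proof.
rewrite /lp_vertex /=; set e := tval _.
have [ke|ke] := ltnP k (size e); last by rewrite !take_oversize ?lexx ?(leqW ke) //; lia.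
by rewrite (take_nth false ke) -cats1 count_cat /=; case: (nth _ _ _) => /=; lia.
Qed.

Lemma lp_vertex_stepR (R : realType) n (L : lattice_path n) k :
  (lp_vertex L k).1%:~R <= (lp_vertex L k.+1).1%:~R :> R /\
  (lp_vertex L k.+1).1%:~R <= (lp_vertex L k).1%:~R + 1 :> R.
Proof.
have /andP[h1 h2] := lp_vertex_step L k; split; first by rewrite ler_int.
by rewrite (_ : _ + 1 = ((lp_vertex L k).1 + 1)%:~R) ?ler_int // intrD.
Qed.

(** The right endpoint is included: there the truncation has jumped to [k.+1], but both
    interpolations give the same vertex. *)
Lemma path_x_segment (R : realType) n (L : lattice_path n) k (t : R) :
  k%:R <= t <= k.+1%:R ->
  path_x L t = (lp_vertex L k).1%:~R +
    (t - k%:R) * ((lp_vertex L k.+1).1%:~R - (lp_vertex L k).1%:~R).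
Proof.
move=> /andP[kt]; rewrite le_eqVlt => /orP[/eqP ->|tk].
  by rewrite /path_x natrK subrr mul0r addr0 -natr1; ring.
by rewrite /path_x (@truncn_def _ _ k) ?kt ?tk // intrB.
Qed.

Lemma path_x_nat (R : realType) n (L : lattice_path n) k :
  path_x L k%:R = (lp_vertex L k).1%:~R :> R.
Proof. by rewrite /path_x natrK subrr mul0r addr0. Qed.

(** The lower-right corner of a box lies on the line of the next content, which is still at most
    [n]. *)
Lemma shape_content (R : realType) n (L M : lattice_path n) b :
  shape_between R L M b -> b.2 < b.1 /\ (0 < box_content b < n)%N.
Proof.
case: b => x y [/= yx] /(_ ((x + 1)%:~R, y%:~R)) /=.
rewrite /box_region /region_between /= !in_itv /= !ler_int.
move=> /(_ ltac:(split; lia)) [/andP[_]].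
by rewrite -intrB pmulrn ler_int /box_content /=; lia.
Qed.

(** The lower-left and upper-right corners both lie on the line of content [c], which gives
    necessity. Conversely the abscissa of a path grows at rate between 0 and 1 in the content, so
    bounds on that line extend to the whole box. *)
Lemma shape_betweenP (R : realType) n (L M : lattice_path n) (c : nat) (x : int) :
  (0 < c < n)%N ->
  shape_between R L M (x, x - c%:Z) <->
  (lp_vertex L c).1 <= x < (lp_vertex M c).1.
Proof.
move=> cn; split.
  move=> [/= yx sub].
  have := sub (x%:~R, (x - c%:Z)%:~R); have := sub ((x + 1)%:~R, (x - c%:Z + 1)%:~R).
  rewrite /box_region /region_between /= !in_itv /= !ler_int.
  move=> /(_ ltac:(split; lia)) [_ /andP[_ +]] /(_ ltac:(split; lia)) [_ /andP[+ _]].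
  rewrite -!intrB.
  have -> : x - (x - c%:Z) = c by ring.
  have -> : x + 1 - (x - c%:Z + 1) = c by ring.
  rewrite -pmulrn !path_x_nat !ler_int lezD1 => h1 h2.
  by apply/andP; split.
move=> /andP[xL xM]; split; first by rewrite /=; lia.
have xMR : x%:~R + 1 <= (lp_vertex M c).1%:~R :> R.
  by rewrite -[1]/(1%:~R) -intrD ler_int; lia.
have xLR : (lp_vertex L c).1%:~R <= x%:~R :> R by rewrite ler_int.
case=> p q [/=]; rewrite /region_between /= !in_itv /= !(intrB, intrD) -!pmulrn.
move=> /andP[p1 p2] /andP[q1 q2].
have c1 : c.-1%:R = c%:R - 1 :> R by rewrite -subn1 natrB //; case/andP: cn.
have cnR : c.+1%:R <= n%:R :> R by rewrite ler_nat; case/andP: cn.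
have c0 : 0 <= c.-1%:R :> R by [].
have cS : c.+1%:R = c%:R + 1 :> R by rewrite -natr1.
have cp : c.-1.+1 = c by lia.
split; first by apply/andP; split; lra.
have [tc|tc] := leP c%:R (p - q).
  rewrite !(@path_x_segment _ _ _ c) ?tc; try lra.
  move: (lp_vertex_stepR R L c) (lp_vertex_stepR R M c) => -[sL1 sL2] [sM1 sM2].
  by apply/andP; split; nra.
rewrite !(@path_x_segment _ _ _ c.-1); try by rewrite cp; lra.
move: (lp_vertex_stepR R L c.-1) (lp_vertex_stepR R M c.-1); rewrite cp => -[sL1 sL2] [sM1 sM2].
rewrite c1; apply/andP; split; nra.
Qed.

(** * Height functions of permutations *)

Lemma measure_bigsetU_le d (T : measurableType d) (R : realType)
    (mu : {measure set T -> \bar R}) (I : finType) (P : pred I) (F : I -> set T) :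
  (forall i, measurable (F i)) ->
  (mu (\big[setU/set0]_(i | P i) F i) <= \sum_(i | P i) mu (F i))%E.
Proof.
move=> mF; suff [] : measurable (\big[setU/set0]_(i | P i) F i) /\
  (mu (\big[setU/set0]_(i | P i) F i) <= \sum_(i | P i) mu (F i))%E by [].
elim/big_ind2 : _ => [|A a B b [mA Aa] [mB Bb]|i _]; last by [].
  by rewrite measure0.
split; first exact: measurableU.
exact: (le_trans (measureU2 mu mA mB) (leeD Aa Bb)).
Qed.

Lemma lebesgue_measure_rect (R : realType) (A B : interval R) (a b : R) :
  lebesgue_measure [set` A] = a%:E -> lebesgue_measure [set` B] = b%:E ->
  (lebesgue_measure \x lebesgue_measure)%E ([set` A] `*` [set` B]) = (a * b)%:E.
Proof.
move=> Aa Bb; rewrite product_measure1E; try exact: measurable_itv.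
by rewrite EFinM; exact: (congr2 mule Aa Bb).
Qed.

Lemma perm_permutonE (R : realType) n (u : 'S_n) (A : set (plane R)) :
  perm_permuton R u A =
  (n%:R%:E * (lebesgue_measure \x lebesgue_measure) (A `&` perm_squares R u))%E.
Proof. by []. Qed.

Lemma measurable_rect (R : realType) (A B : interval R) :
  measurable ([set` A] `*` [set` B] : set (plane R)).
Proof. by apply: measurableX; exact: measurable_itv. Qed.

Lemma lebesgue_measure_cell (R : realType) n k b c : (0 < n)%N ->
  lebesgue_measure
    [set` Interval (BSide b (k%:R / n%:R)) (BSide c (k.+1%:R / n%:R))] =
  (n%:R^-1 : R)%:E.
Proof.
move=> n0; have n0R : 0 < n%:R :> R by rewrite ltr0n.
rewrite lebesgue_measure_itv /= lte_fin ltr_pM2r ?invr_gt0 // ltr_nat ltnSn.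
rewrite -EFinD; congr EFin; rewrite -mulrBl -natr1.
by rewrite (addrC k%:R) addrK mul1r.
Qed.

(** Mass of the squares counted by [rk u i j]: each has area [n^-2] and density [n]. *)
Lemma sum_rk (R : realType) n (u : 'S_n) i j : (0 < n)%N ->
  (n%:R%:E * \sum_(k < n | (i <= k)%N && (u k < j)%N)
      (n%:R^-1 * n%:R^-1 : R)%:E)%E =
  ((rk u i j)%:R / n%:R)%:E.
Proof.
move=> n0; have n0R : n%:R != 0 :> R by rewrite pnatr_eq0 -lt0n.
rewrite sumEFin -EFinM sumr_const (_ : #|_| = rk u i j).
  by congr EFin; rewrite -[X in _ * X]mulr_natl; field.
by rewrite -sum1_card big_mkcond.
Qed.

Definition corner (R : realType) (x y : R) : set (plane R) :=
  `[x, 1] `*` `[0, y].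

Lemma height_perm_le (R : realType) n (u : 'S_n) (x y : R) : (0 < n)%N ->
  (perm_permuton R u (corner x y) <=
   ((rk u (Num.truncn (n%:R * x)) (Num.truncn (n%:R * y)).+1)%:R / n%:R)%:E)%E.
Proof.
move=> n0; have n0R : 0 < n%:R :> R by rewrite ltr0n.
rewrite /corner; set i := Num.truncn _; set j := Num.truncn _.
rewrite perm_permutonE -sum_rk // lee_pmul2l //.
pose Q (k : 'I_n) : set (plane R) :=
  (`[x, 1] `&` `[k%:R / n%:R, k.+1%:R / n%:R]) `*`
  (`[0, y] `&` `[(u k)%:R / n%:R, (u k).+1%:R / n%:R]).
have mQ k : measurable (Q k).
  by apply: measurableX; apply: measurableI; exact: measurable_itv.
apply: (@le_trans _ _ (\sum_(k < n) (lebesgue_measure \x lebesgue_measure)%E (Q k))%E).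
  apply: le_trans (measure_bigsetU_le _ _ _) => //.
  apply: le_measure; rewrite ?inE; [|exact: bigsetU_measurable|].
    by apply: measurableI; [exact: measurable_rect|exact: measurable_perm_squares].
  move=> p [[p1 p2] [k _ [q1 q2]]]; rewrite (bigD1 k) //; left.
  by split; split.
rewrite [leRHS]big_mkcond /=; apply: lee_sum => k _.
have cell a : lebesgue_measure `[a%:R / n%:R, a.+1%:R / n%:R] = (n%:R^-1 : R)%:E.
  exact: lebesgue_measure_cell.
case: ifPn => [_|].
  rewrite -(lebesgue_measure_rect (cell k) (cell (u k))).
  apply: le_measure; rewrite ?inE //; first exact: measurable_rect.
  by move=> p [[_ ?] [_ ?]]; split.
rewrite /Q product_measure1E; try by apply: measurableI; exact: measurable_itv.
(* A square left of the corner meets it at most in the vertical line of abscissa [k.+1 / n], a null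
   set; a square above the corner misses it altogether. *)
rewrite negb_and -!ltnNge => /orP[ki|ju].
  rewrite [X in (X * _)%E](_ : _ = 0%E) ?mul0e //.
  apply: (subset_measure0 (mu := lebesgue_measure) (B := `[k.+1%:R / n%:R, k.+1%:R / n%:R])).
  - by apply: measurableI; exact: measurable_itv.
  - exact: measurable_itv.
  - move=> z [/=]; rewrite !in_itv /= => /andP[xz _] /andP[_ zk].
    apply/andP; split=> //; rewrite ler_pdivrMr //.
    have : k.+1%:R <= n%:R * x.
      have [x0|x0] := leP 0 (n%:R * x).
        by rewrite -truncn_ge_nat.
      by move: ki; rewrite /i truncn_floor leNgt x0.
    by nra.
  - by rewrite set_itv1; exact: lebesgue_measure_set1.
rewrite [X in (_ * X)%E](_ : _ = 0%E) ?mule0 //.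
rewrite (_ : _ `&` _ = set0) ?measure0 // -subset0 => z [/=].
rewrite !in_itv /= => /andP[_ zy]; rewrite ler_pdivrMr // => /andP[uz _].
have : n%:R * y < (u k)%:R.
  by apply: lt_le_trans (truncnS_gt _) _; rewrite ler_nat.
by nra.
Qed.

(** The counted squares lie inside the corner. They are taken half-open, hence disjoint, so that
    their areas add up. *)
Lemma height_perm_ge (R : realType) n (u : 'S_n) (x y : R) : (0 < n)%N ->
  x <= 1 -> 0 <= y ->
  (((rk u (Num.truncn (n%:R * x)).+1 (Num.truncn (n%:R * y)))%:R / n%:R)%:E <=
   perm_permuton R u (corner x y))%E.
Proof.
move=> n0 x1 y0; have n0R : 0 < n%:R :> R by rewrite ltr0n.
rewrite /corner; set i := Num.truncn _; set j := Num.truncn _.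
rewrite perm_permutonE -sum_rk // lee_pmul2l //.
pose Q (k : 'I_n) : set (plane R) :=
  `[k%:R / n%:R, k.+1%:R / n%:R[ `*` `[(u k)%:R / n%:R, (u k).+1%:R / n%:R[.
have mQ k : measurable (Q k) by exact: measurable_rect.
have QE k : (lebesgue_measure \x lebesgue_measure)%E (Q k) = (n%:R^-1 * n%:R^-1)%:E.
  by apply: lebesgue_measure_rect; exact: lebesgue_measure_cell.
rewrite (eq_bigr (fun k => (lebesgue_measure \x lebesgue_measure)%E (Q k))); last first.
  by move=> k _; rewrite QE.
rewrite -measure_bigsetU_ord //; last first.
  apply/trivIsetP => k l _ _ kl; rewrite -subset0 => p [[/= p1 _] [/= p2 _]].
  move: p1 p2; rewrite !in_itv /= !ler_pdivrMr // !ltr_pdivlMr // => /andP[k1 k2] /andP[l1 l2].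
  have := le_lt_trans k1 l2; have := le_lt_trans l1 k2; rewrite !ltr_nat => a b.
  by case/eqP: kl; apply: val_inj => /=; lia.
apply: le_measure; rewrite ?inE.
- exact: bigsetU_measurable.
- by apply: measurableI; [exact: measurable_rect|exact: measurable_perm_squares].
move=> p; rewrite -bigcup_seq_cond => -[k /= /andP[_ /andP[ik uj]] [/= p1 p2]].
have kn : k.+1%:R <= n%:R :> R by rewrite ler_nat.
have xi : n%:R * x < k%:R by apply: (lt_le_trans (truncnS_gt _)); rewrite ler_nat.
have jy : (u k).+1%:R <= n%:R * y by rewrite -truncn_ge_nat // mulr_ge0 // ltW.
have u0 : 0 <= (u k)%:R :> R by [].
move: p1 p2; rewrite !in_itv /= !ler_pdivrMr // !ltr_pdivlMr // => /andP[a1 a2] /andP[b1 b2].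
split; last first.
  exists k => //; split; rewrite /= in_itv /= ?ler_pdivrMr // ?ler_pdivlMr //; apply/andP; split=> //; exact: ltW.
have n1 : p.1 <= 1 by rewrite -(ler_pM2r n0R); lra.
split=> /=; first by rewrite n1 andbT -(ler_pM2r n0R); lra.
by apply/andP; split; rewrite -(ler_pM2r n0R) ?mul0r; lra.
Qed.

(** The upper and lower bounds shift one index of [rk] by one, which changes the count by at most
    one. *)
Lemma height_perm_rk (R : realType) n (u : 'S_n) (x y : R) : (0 < n)%N ->
  x \in `[0, 1] -> y \in `[0, 1] ->
  `|permuton_height (perm_permuton R u) x y -
    (rk u (Num.truncn (n%:R * x)) (Num.truncn (n%:R * y)))%:R / n%:R| <= n%:R^-1.
Proof.
move=> n0; rewrite !in_itv /= => /andP[x0 x1] /andP[y0 y1].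
have n0R : 0 < n%:R :> R by rewrite ltr0n.
have := height_perm_le u x y n0; have := height_perm_ge u n0 x1 y0.
rewrite /permuton_height -/(corner x y).
set i := Num.truncn _; set j := Num.truncn _.
have : (0 <= perm_permuton R u (corner x y))%E by [].
case: (perm_permuton R u _) => [h||] //= _; rewrite !lee_fin.
rewrite ler_pdivlMr // ler_pdivrMr // => hl hu.
have /andP[_ ] := rk_le_succ u i j; have /andP[_] := rk_le_succr u i j.
rewrite -!(ler_nat R) -!natr1 => a b.
rewrite ler_norml lerBlDr lerBrDr -(addrC (_ / _)) -[X in _ <= X + _]mul1r.
rewrite -[X in - X]mul1r -mulrDl -mulNr -mulrDl ler_pdivrMr // ler_pdivlMr //.
by apply/andP; split; lra.
Qed.

(** * Passing to the limit in the minimum *)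

Lemma lipschitz_attains_min (R : realType) (g : R -> R) (C : R) :
  (forall a b, a \in `[0, 1] -> b \in `[0, 1] -> `|g a - g b| <= C * `|a - b|) ->
  exists m, is_min_on_unit g m.
Proof.
move=> gC; have cg : {within `[0, 1], continuous g}.
  apply/subspace_continuousP => a a01; apply/cvgrPdist_le => e e0.
  have C1 : 0 < `|C| + 1 by rewrite ltr_wpDl.
  rewrite near_withinE; near=> t => t01.
  apply: le_trans (gC _ _ a01 t01) _.
  have ta : `|a - t| <= e / (`|C| + 1).
    by near: t; apply: cvgr_dist_le; rewrite ?divr_gt0.
  have C2 := ler_norm C; have N0 := normr_ge0 (a - t).
  by move: ta; rewrite ler_pdivlMr //; nra.
have [c c01 cm] := EVT_min ler01 cg.
by exists (g c); split; [exists c|].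
Unshelve. all: by end_near. Qed.

Lemma truncn_bounds (R : realType) (x : R) : 0 <= x ->
  (Num.truncn x)%:R <= x /\ x <= (Num.truncn x)%:R + 1.
Proof.
move=> x0; have /andP[h1 h2] := truncn_itv x0.
by split => //; rewrite natr1 ltW.
Qed.

Lemma truncn_mul_le (R : realType) n (x : R) : x \in `[0, 1] ->
  (Num.truncn (n%:R * x) <= n)%N.
Proof.
rewrite in_itv /= => /andP[x0 x1].
by rewrite truncn_le_nat -natr1; have : 0 <= n%:R :> R by []; nra.
Qed.

Lemma cvg_truncn_div (R : realType) (x : R) : 0 <= x ->
  (Num.truncn (n%:R * x))%:R / n%:R @[n --> \oo] --> x.
Proof.
move=> x0; apply/cvgrPdist_le => e e0; near=> n.
have n0 : 0 < n%:R :> R by rewrite ltr0n; near: n; exists 1%N.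
have [h1 h2] := truncn_bounds (mulr_ge0 (ltW n0) x0).
have ne : e^-1 <= n%:R by near: n; exact: nbhs_infty_ger.
have ne1 : 1 <= e * n%:R by rewrite -ler_pdivrMl // mulr1.
rewrite ler_distl; apply/andP; split.
  rewrite lerBlDr -(ler_pM2r n0) mulrDl mulfVK ?gt_eqF //; nra.
by rewrite -lerBlDr -(ler_pM2r n0) mulrBl mulfVK ?gt_eqF //; nra.
Unshelve. all: by end_near. Qed.

(** The common Lipschitz constant reduces both minima to a fixed finite grid, on which pointwise
    convergence is uniform. *)
Lemma cvg_seq_min (R : realType) (g : R -> R) (C m : R) (G : nat -> nat -> R)
    (M : nat -> R) :
  0 <= C ->
  (forall a b, a \in `[0, 1] -> b \in `[0, 1] -> `|g a - g b| <= C * `|a - b|) ->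
  is_min_on_unit g m ->
  (forall n a b, (0 < n)%N -> (a <= n)%N -> (b <= n)%N ->
    `|G n a - G n b| <= C * `|a%:R / n%:R - b%:R / n%:R|) ->
  (forall n, (0 < n)%N -> (forall a, (a <= n)%N -> M n <= G n a) /\
     exists2 a, (a <= n)%N & M n = G n a) ->
  (forall N k, (k <= N.+1)%N ->
     G n (Num.truncn (n%:R * (k%:R / N.+1%:R : R))) @[n --> \oo] --> g (k%:R / N.+1%:R)) ->
  M n @[n --> \oo] --> m.
Proof.
move=> C0 gC [[c c01 gc] gm] GC MG Gg; apply/cvgrPdist_le => e e0.
(* The mesh [w] is chosen so that moving by [w] changes [g] by at most [e / 8]. *)
pose N := Num.truncn (8 * C / e); pose w : R := N.+1%:R^-1.
have w0 : 0 < w by rewrite invr_gt0 ltr0n.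
have Cw : C * w <= e / 8.
  have := truncnS_gt (8 * C / e); rewrite -/N => h.
  have h' : 8 * C < N.+1%:R * e by rewrite -ltr_pdivrMr.
  by rewrite /w ler_pdivrMr ?ltr0n //; nra.
have grid t : t \in `[0, 1] -> exists2 k, (k <= N.+1)%N & `|t - k%:R * w| <= w.
  move=> t01; exists (Num.truncn (N.+1%:R * t)); first exact: truncn_mul_le.
  move: t01; rewrite in_itv /= => /andP[t0 t1].
  have [h1 h2] := truncn_bounds (mulr_ge0 (ler0n R N.+1) t0).
  have N0 : 0 < N.+1%:R :> R by rewrite ltr0n.
  have ww : w * N.+1%:R = 1 by rewrite /w mulVf ?gt_eqF.
  rewrite ler_distl; apply/andP; split; rewrite -(ler_pM2r N0).
    by rewrite mulrBl -mulrA ww; lra.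
  by rewrite mulrDl -mulrA ww; lra.
have grid01 k : (k <= N.+1)%N -> k%:R * w \in `[0, 1].
  move=> kN; rewrite in_itv /= mulr_ge0 ?(ltW w0) //=.
  by rewrite /w ler_pdivrMr ?ltr0n // mul1r ler_nat.
near=> n.
have n0 : (0 < n)%N by near: n; exists 1%N.
have nR : 0 < n%:R :> R by rewrite ltr0n.
have nw : n%:R^-1 <= w.
  rewrite /w lef_pV2 ?posrE ?ltr0n // ler_nat; near: n; exact: nbhs_infty_ge.
have Gn : forall k : 'I_N.+2, `|g (k%:R * w) - G n (Num.truncn (n%:R * (k%:R * w)))| <= e / 8.
  near: n; apply: filter_forall => k.
  have e8 : 0 < e / 8 by rewrite divr_gt0.
  have kN : (k <= N.+1)%N by rewrite -ltnS.
  by have /cvgrPdist_le/(_ _ e8) := Gg N k kN.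
have {}Gn k : (k <= N.+1)%N ->
    `|g (k%:R * w) - G n (Num.truncn (n%:R * (k%:R * w)))| <= e / 8.
  by move=> kN; exact: (Gn (Ordinal (kN : (k < N.+2)%N))).
have [Mle [a an Ma]] := MG n n0.
(* To bound [m] by [M n + e], the discrete minimizer [a] is moved to a grid point and then to its
   truncation, each at cost at most [w]. For the other inequality the grid point next to the
   minimizer [c] of [g] is used. *)
rewrite ler_distl; apply/andP; split; last first.
  have a01 : (a%:R / n%:R : R) \in `[0, 1]%R.
    by rewrite in_itv /= divr_ge0 //= ler_pdivrMr // mul1r ler_nat.
  have [k kN ak] := grid _ a01.
  have b01 := grid01 k kN.
  set b := Num.truncn (n%:R * (k%:R * w)); have bn : (b <= n)%N by exact: truncn_mul_le.
  have kb : `|k%:R * w - b%:R / n%:R| <= w.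
    move: b01; rewrite in_itv /= => /andP[b0 _].
    have [h1 h2] := truncn_bounds (mulr_ge0 (ltW nR) b0).
    have nn : n%:R^-1 * n%:R = 1 :> R by rewrite mulVf ?gt_eqF.
    apply: (le_trans _ nw); rewrite ler_distl; apply/andP; split; rewrite -(ler_pM2r nR).
      by rewrite mulrBl divfK ?gt_eqF // nn /b; lra.
    by rewrite mulrDl divfK ?gt_eqF // nn /b; lra.
  have := GC n a b n0 an bn; have := Gn k kN; have := gm _ b01; rewrite -/b Ma.
  have ab : `|a%:R / n%:R - b%:R / n%:R| <= 2 * w.
    rewrite (_ : _ - _ = (a%:R / n%:R - k%:R * w) + (k%:R * w - b%:R / n%:R)); last by ring.
    by apply: le_trans (ler_normD _ _) _; lra.
  have Cab : C * `|a%:R / n%:R - b%:R / n%:R| <= C * (2 * w) by rewrite ler_wpM2l.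
  by rewrite !ler_norml => h1 /andP[h2 h3] /andP[h4 h5]; lra.
have [k kN ck] := grid _ c01.
have b01 := grid01 k kN.
have bn : (Num.truncn (n%:R * (k%:R * w)) <= n)%N by exact: truncn_mul_le.
have := Mle _ bn; have := Gn k kN; have := gC _ _ b01 c01; rewrite gc.
have Cck : C * `|k%:R * w - c| <= C * w by rewrite ler_wpM2l // distrC.
by rewrite !ler_norml => /andP[h1 h2] /andP[h3 h4] h5; lra.
Unshelve. all: by end_near. Qed.

Lemma cvg_maxr (T : Type) (F : set_system T) (FF : Filter F) (R : realType)
    (f g : T -> R) (a b : R) :
  f t @[t --> F] --> a -> g t @[t --> F] --> b ->
  Num.max (f t) (g t) @[t --> F] --> Num.max a b.
Proof.
move=> fa gb; rewrite maxr_absE.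
under eq_cvg do rewrite maxr_absE.
by apply: cvgM; [apply: cvgD|exact: cvg_cst]; [exact: cvgD|apply: cvg_norm; exact: cvgB].
Qed.

Lemma cvg_minr (T : Type) (F : set_system T) (FF : Filter F) (R : realType)
    (f g : T -> R) (a b : R) :
  f t @[t --> F] --> a -> g t @[t --> F] --> b ->
  Num.min (f t) (g t) @[t --> F] --> Num.min a b.
Proof.
move=> fa gb; rewrite minr_absE.
under eq_cvg do rewrite minr_absE.
by apply: cvgM; [apply: cvgB|exact: cvg_cst]; [exact: cvgD|apply: cvg_norm; exact: cvgB].
Qed.

Lemma cvg_of_dist_inv (R : realType) (f g : nat -> R) (l : R) :
  (forall n, (0 < n)%N -> `|f n - g n| <= n%:R^-1) ->
  f n @[n --> \oo] --> l -> g n @[n --> \oo] --> l.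
Proof.
move=> fg fl; apply/cvgrPdist_le => e e0.
have e2 : 0 < e / 2 by rewrite divr_gt0.
near=> n.
have n0 : (0 < n)%N by near: n; exists 1%N.
have h1 : `|l - f n| <= e / 2 by near: n; by apply: cvgr_dist_le fl _ e2.
have ne : (e / 2)^-1 <= n%:R by near: n; exact: nbhs_infty_ger.
have ni : n%:R^-1 <= e / 2 by rewrite -[e / 2]invrK lef_pV2 ?posrE ?invr_gt0 ?ltr0n.
rewrite (_ : l - g n = (l - f n) + (f n - g n)); last by ring.
apply: le_trans (ler_normD _ _) _; have := fg n n0; lra.
Unshelve. all: by end_near. Qed.

(** * Scaled boundary paths and the exact discrete variational formula *)

Lemma path_theta_vertex (R : realType) n (L : lattice_path n) (z : R) :
  (0 < n)%N -> 0 <= z ->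
  `|path_theta L z - (lp_vertex L (Num.truncn (n%:R * z))).1%:~R / n%:R| <= n%:R^-1.
Proof.
move=> n0 z0; have n0R : 0 < n%:R :> R by rewrite ltr0n.
rewrite /path_theta /path_x; set k := Num.truncn _.
have [h1 h2] := truncn_bounds (mulr_ge0 (ltW n0R) z0).
rewrite -/k in h1 h2; rewrite -mulrBl addrC addKr normrM normfV [`|n%:R|]gtr0_norm //.
rewrite ler_piMl ?invr_ge0 ?(ltW n0R) // intrB.
have [s1 s2] := lp_vertex_stepR R L k.
rewrite ler_norml; apply/andP; split; nra.
Qed.

(** Each step of a lattice path raises the abscissa by 0 or 1; after scaling, both inequalities pass
    to the limit. *)
Lemma path_theta_homo (R : realType) (L : forall n, lattice_path n) (f : R -> R) :
  (forall z : R, z \in `[0, 1] -> path_theta (L n) z @[n --> \oo] --> f z) ->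
  forall a b : R, a \in `[0, 1] -> b \in `[0, 1] -> a <= b ->
  f a <= f b <= f a + (b - a).
Proof.
move=> Lf a b a01 b01 ab.
have [a0 a1] : 0 <= a /\ a <= 1 by move: a01; rewrite in_itv /= => /andP[].
have b0 := le_trans a0 ab.
have X (z : R) : z \in `[0, 1] -> (lp_vertex (L n) (Num.truncn (n%:R * z))).1%:~R / n%:R
    @[n --> \oo] --> f z.
  move=> z01; apply: cvg_of_dist_inv (Lf z z01) => n n0.
  by apply: path_theta_vertex => //; move: z01; rewrite in_itv /= => /andP[].
have le n : (0 < n)%N ->
    (lp_vertex (L n) (Num.truncn (n%:R * a))).1 <= (lp_vertex (L n) (Num.truncn (n%:R * b))).1 <=
    (lp_vertex (L n) (Num.truncn (n%:R * a))).1 +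
    ((Num.truncn (n%:R * b))%:Z - (Num.truncn (n%:R * a))%:Z).
  move=> n0; have tab : (Num.truncn (n%:R * a) <= Num.truncn (n%:R * b))%N.
    by apply: le_truncn; rewrite ler_wpM2l.
  have := @unit_steps_homo n (fun k => (lp_vertex (L n) k).1) _ _ _ _.
  move=> /(_ (Num.truncn (n%:R * a)) (Num.truncn (n%:R * b))) /(_ (fun k _ => lp_vertex_step _ k)).
  by rewrite tab truncn_mul_le // => /(_ isT); rewrite -subzn.
apply/andP; split.
  apply: (ler_cvg_to (X a a01) (X b b01)); near=> n.
  have n0 : (0 < n)%N by near: n; exists 1%N.
  by rewrite ler_pM2r ?invr_gt0 ?ltr0n // ler_int; case/andP: (le n n0).
have Y : (lp_vertex (L n) (Num.truncn (n%:R * a))).1%:~R / n%:R +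
    ((Num.truncn (n%:R * b))%:R / n%:R - (Num.truncn (n%:R * a))%:R / n%:R)
    @[n --> \oo] --> f a + (b - a).
  by apply: cvgD; [exact: X|apply: cvgB; exact: cvg_truncn_div].
apply: (ler_cvg_to (X b b01) Y); near=> n.
have n0 : (0 < n)%N by near: n; exists 1%N.
rewrite /= -mulrBl -mulrDl ler_pM2r ?invr_gt0 ?ltr0n //.
have /andP[_] := le n n0.
by rewrite -(ler_int R) intrD intrB.
Unshelve. all: by end_near. Qed.

(** Discrete counterpart, multiplied by [n], of the function minimized in the limit, at [x = i / n],
    [y = j / n] and minimization variable [a / n]. *)
Definition seq_cost n (L M : lattice_path n) i j (v : 'S_n) (a : nat) : int :=
  (rk v a j)%:Z +
  Num.min (Num.max 0 (Num.max (a%:Z - i%:Z)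
             ((lp_vertex M i).1 - (lp_vertex L a).1 + a%:Z - i%:Z)))
    (Num.min (n%:Z - i%:Z) a%:Z).

(* The cap [j] of [passage] becomes [a], as in [h1]: rk v a j + a >= j, with
   equality at a = 0. *)
Lemma seq_cost_min (R : realType) n (L M : lattice_path n) s (v : 'S_n) i j :
  (0 < n)%N -> weakly_southwest R L M -> linear_extension (shape_between R L M) s ->
  (i <= n)%N -> (j <= n)%N ->
  let r := (rk (tau_word (map box_content s) v) i j)%:Z in
  (forall a, (a <= n)%N -> r <= seq_cost L M i j v a) /\
  (exists2 a, (a <= n)%N & r = seq_cost L M i j v a).
Proof.
move=> n0 LM [us sS sle] i_n jn /=.
have ss b : b \in s <-> shape_between R L M b by rewrite -sS.
have [] := @rk_tau_word n v j (fun k => (lp_vertex L k).1) (fun k => (lp_vertex M k).1) s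
  jn (fun k _ => lp_vertex_step L k) (fun k _ => lp_vertex_step M k) _ us _ _ sle i i_n.
- move=> k /andP[_ /ltnW kn]; have := LM k%:R; rewrite !path_x_nat ler_int; apply.
  by rewrite ler0n ler_nat.
- by move=> b /ss /shape_content.
- move=> c x cn; apply/idP/idP => [/ss|h]; first by rewrite shape_betweenP.
  by apply/ss; rewrite shape_betweenP.
set r := rk _ _ _ => rj rn ra req.
have v0 := rk0 v jn; have vn := @rk_oversize n v n j (leqnn n).
have ler_ a : (a <= n)%N -> r%:Z <= seq_cost L M i j v a.
  move=> an; have := ra a an; have := rk_homo v j (leq0n a); rewrite /seq_cost; lia.
(* The cap [j] is the term [a = 0] and the cap [n - i] is the term [a = n]. Any other minimizer
   keeps its value, since the truncated cost lies between [r] and the untruncated one. *)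
split=> //; case: req => [e|e|[a an e]].
- by exists 0%N => //; rewrite /seq_cost v0; lia.
- by exists n => //; rewrite /seq_cost vn; lia.
- by exists a => //; have := ler_ a an; rewrite /seq_cost; lia.
Qed.

(** One unit per step comes from the row of [v], and one from the path term. *)
Lemma seq_cost_lipschitz n (L M : lattice_path n) i j (v : 'S_n) a b :
  (a <= b)%N -> (b <= n)%N ->
  `|seq_cost L M i j v a - seq_cost L M i j v b| <= 2 * (b%:Z - a%:Z).
Proof.
move=> ab bn; have := @unit_steps_homo n (fun k => (lp_vertex L k).1) a b
  (fun k _ => lp_vertex_step _ k); rewrite ab bn => /(_ isT).
by have := rk_homo v j ab; rewrite /seq_cost; lia.
Qed.

(** Every entry of the minimum and the maximum is nondecreasing in the second variable with slope at
    most 1; for the entry containing [phi] this is the assumed growth of [phi]. *)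
Lemma h1_homo (R : realType) (phi psi : R -> R) (x a b : R) : a <= b ->
  phi a <= phi b <= phi a + (b - a) ->
  h1 phi psi x a <= h1 phi psi x b <= h1 phi psi x a + (b - a).
Proof.
move=> ab /andP[p1 p2]; rewrite /h1 !(addr_minl, addr_maxl).
by apply/andP; split; repeat (apply: le_min2 || apply: le_max2); lra.
Qed.

Lemma dist_le_of_homo (R : realType) (C : R) (f : R -> R) :
  (forall a b, a \in `[0, 1] -> b \in `[0, 1] -> a <= b ->
    `|f a - f b| <= C * (b - a)) ->
  forall a b, a \in `[0, 1] -> b \in `[0, 1] -> `|f a - f b| <= C * `|a - b|.
Proof.
move=> fC a b a01 b01; have [ab|/ltW ba] := leP a b.
  by rewrite (distrC a) [`|b - a|]ger0_norm ?subr_ge0 //; exact: fC.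
by rewrite distrC [`|a - b|]ger0_norm ?subr_ge0 //; exact: fC.
Qed.

Lemma intr_min (R : numDomainType) (a b : int) :
  (Num.min a b)%:~R = Num.min a%:~R b%:~R :> R.
Proof. by rewrite !minEle ler_int; case: ifP. Qed.

Lemma intr_max (R : numDomainType) (a b : int) :
  (Num.max a b)%:~R = Num.max a%:~R b%:~R :> R.
Proof. by rewrite !maxEle ler_int; case: ifP. Qed.

Lemma seq_costE (R : realType) n (L M : lattice_path n) i j (v : 'S_n) a :
  (0 < n)%N ->
  (seq_cost L M i j v a)%:~R / n%:R =
  (rk v a j)%:R / n%:R +
  Num.min (Num.max 0 (Num.max (a%:R / n%:R - i%:R / n%:R)
     ((lp_vertex M i).1%:~R / n%:R - (lp_vertex L a).1%:~R / n%:R +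
      a%:R / n%:R - i%:R / n%:R)))
   (Num.min (1 - i%:R / n%:R) (a%:R / n%:R)) :> R.
Proof.
move=> n0; have n0R : 0 < n%:R :> R by rewrite ltr0n.
have ni : 0 <= n%:R^-1 :> R by rewrite invr_ge0 ltW.
rewrite /seq_cost; move: (lp_vertex M i).1 (lp_vertex L a).1 => p q.
rewrite !(intrD, intr_min, intr_max, mulrNz) -!pmulrn mulrDl.
rewrite !(minr_pMl, maxr_pMl) // mul0r; congr (_ + _).
by rewrite !(mulrDl, mulNr) mulfV ?gt_eqF.
Qed.

Section Deterministic.
Variables (R : realType) (phi psi : R -> R).
Variables (Lsw Lne : forall n, lattice_path n).
Hypothesis hsw : forall n, (0 < n)%N -> weakly_southwest R (Lsw n) (Lne n).
Hypothesis cvg_sw : forall z : R, z \in `[0, 1] ->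
    path_theta (Lsw n) z @[n --> \oo] --> phi z.
Hypothesis cvg_ne : forall z : R, z \in `[0, 1] ->
    path_theta (Lne n) z @[n --> \oo] --> psi z.
(** [F] is the limiting height of [v n] at a fixed [y]: the height of the permuton, or [(1 - g) * y]
    for uniform permutations. *)
Variable F : R -> R.
Hypothesis FL : forall a b, a \in `[0, 1] -> b \in `[0, 1] ->
  `|F a - F b| <= `|a - b|.

Let cost_lipschitz (x a b : R) : a \in `[0, 1] -> b \in `[0, 1] ->
  `|(F a + h1 phi psi x a) - (F b + h1 phi psi x b)| <= 2 * `|a - b|.
Proof.
move: a b; apply: (@dist_le_of_homo _ 2 (fun a => F a + h1 phi psi x a)) => a b a01 b01 ab /=.
have /andP[h1 h2] := h1_homo psi x ab (path_theta_homo cvg_sw a01 b01 ab).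
have := FL a01 b01; rewrite (distrC a) [`|b - a|]ger0_norm ?subr_ge0 // ler_norml => /andP[f1 f2].
rewrite ler_norml; apply/andP; split; lra.
Qed.

Lemma cost_attains_min (x : R) :
  exists m, is_min_on_unit (fun g => F g + h1 phi psi x g) m.
Proof. exact: lipschitz_attains_min (@cost_lipschitz x). Qed.

(** Convergence of the rows is asked only at rational points, so that in the random case countably
    many almost sure events suffice. *)
Lemma height_cvg (ext : nat -> seq box) (v : forall n, 'S_n) (x y m : R) :
  (forall n, (0 < n)%N ->
    linear_extension (shape_between R (Lsw n) (Lne n)) (ext n)) ->
  x \in `[0, 1] -> y \in `[0, 1] ->
  (forall N k, (k <= N.+1)%N ->
    (rk (v n) (Num.truncn (n%:R * (k%:R / N.+1%:R : R)))
       (Num.truncn (n%:R * y)))%:R / n%:R @[n --> \oo] --> F (k%:R / N.+1%:R)) ->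
  is_min_on_unit (fun g => F g + h1 phi psi x g) m ->
  permuton_height
    (perm_permuton R (tau_word (map box_content (ext n)) (v n))) x y
    @[n --> \oo] --> m.
Proof.
move=> hext x01 y01 vF mm.
have [x0 x1] : 0 <= x /\ x <= 1 by move: x01; rewrite in_itv /= => /andP[].
pose i n := Num.truncn (n%:R * x); pose j n := Num.truncn (n%:R * y).
pose u n := tau_word (map box_content (ext n)) (v n).
suff: (rk (u n) (i n) (j n))%:R / n%:R @[n --> \oo] --> m.
  by apply: cvg_of_dist_inv => n n0; rewrite distrC; exact: height_perm_rk.
pose G n a : R := (seq_cost (Lsw n) (Lne n) (i n) (j n) (v n) a)%:~R / n%:R.
apply: (@cvg_seq_min _ _ 2 _ G _ _ (@cost_lipschitz x) mm) => //.
- move=> n a b n0 an bn; have n0R : 0 < n%:R :> R by rewrite ltr0n.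
  rewrite (_ : a%:R / n%:R - b%:R / n%:R = (a%:Z - b%:Z)%:~R / n%:R :> R); last first.
    by rewrite intrB mulrBl.
  rewrite /G -mulrBl -intrB !normrM normfV [`|n%:R|]gtr0_norm //.
  rewrite mulrA ler_pM2r ?invr_gt0 // -!intr_norm -[2]/(2%:~R) -intrM ler_int.
  have [ab|/ltW ba] := leP (a : nat) b.
    have := @seq_cost_lipschitz n (Lsw n) (Lne n) (i n) (j n) (v n) _ _ ab bn; lia.
  have := @seq_cost_lipschitz n (Lsw n) (Lne n) (i n) (j n) (v n) _ _ ba an; lia.
- move=> n n0.
  have [||h [a an e]] := @seq_cost_min R n (Lsw n) (Lne n) (ext n) (v n) (i n) (j n)
    n0 (hsw n0) (hext n n0).
  + exact: truncn_mul_le.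
  + exact: truncn_mul_le.
  have n0R : 0 < n%:R :> R by rewrite ltr0n.
  split=> [b bn|]; first by rewrite /G ler_pM2r ?invr_gt0 // pmulrn ler_int h.
  by exists a => //; rewrite /G pmulrn e.
move=> N k kN; set g := _ / _.
have g01 : g \in `[0, 1]%R.
  by rewrite in_itv /= divr_ge0 //= ler_pdivrMr ?ltr0n // mul1r ler_nat.
have g0 : 0 <= g by rewrite divr_ge0.
pose a n := Num.truncn (n%:R * g).
have vertex (L : forall n, lattice_path n) f z : z \in `[0, 1]%R ->
    path_theta (L n) z @[n --> \oo] --> f z ->
    (lp_vertex (L n) (Num.truncn (n%:R * z))).1%:~R / n%:R @[n --> \oo] --> (f z : R).
  move=> z01; apply: cvg_of_dist_inv => n n0.
  by apply: path_theta_vertex => //; move: z01; rewrite in_itv /= => /andP[].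
have ca := cvg_truncn_div g0; have ci := cvg_truncn_div x0.
have cM := vertex Lne psi x x01 (cvg_ne x01).
have cL := vertex Lsw phi g g01 (cvg_sw g01).
apply: (@cvg_trans _ ((rk (v n) (a n) (j n))%:R / n%:R +
  Num.min (Num.max 0 (Num.max ((a n)%:R / n%:R - (i n)%:R / n%:R)
     ((lp_vertex (Lne n) (i n)).1%:~R / n%:R - (lp_vertex (Lsw n) (a n)).1%:~R / n%:R +
      (a n)%:R / n%:R - (i n)%:R / n%:R)))
   (Num.min (1 - (i n)%:R / n%:R) ((a n)%:R / n%:R)) @[n --> \oo])).
  apply: near_eq_cvg; near=> n; rewrite /G seq_costE //; near: n; exists 1%N => //.
apply: cvgD; first exact: vF.
apply: cvg_minr; last by apply: cvg_minr => //; apply: cvgB => //; exact: cvg_cst.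
apply: cvg_maxr; first exact: cvg_cst.
apply: cvg_maxr; first exact: cvgB.
by apply: cvgB => //; apply: cvgD => //; exact: cvgB.
Unshelve. all: by end_near. Qed.

End Deterministic.

(** * Weak convergence and height functions *)

Lemma measurable_corner (R : realType) (x y : R) : measurable (corner x y).
Proof. exact: measurable_rect. Qed.

(** The larger corner is covered by the smaller one, a vertical strip and a horizontal strip, whose
    masses are given by the uniform marginals. As these are known only within the square, [x'] and
    [y'] are first clipped to [s] and [t]. *)
Lemma corner_lipschitz (R : realType) (mu : probability (plane R) R) (x x' y y' : R) :
  is_permuton mu -> 0 <= x <= 1 -> 0 <= y <= 1 -> x <= x' -> y' <= y ->
  fine (mu (corner x y)) <= fine (mu (corner x' y')) + (x' - x) + (y - y').
Proof.
move=> pm /andP[x0 x1] /andP[y0 y1] xx yy.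
pose s := Num.min x' 1; pose t := Num.max y' 0.
have [xs s1 sx] : [/\ x <= s, s <= 1 & s <= x'] by rewrite /s !(le_min, ge_min); split; lra.
have [ty t0 yt] : [/\ t <= y, 0 <= t & y' <= t].
  by rewrite /t !(le_max, ge_max) !lexx ?orbT yy y0.
have [_ mx] := pm x s x0 xs s1; have [my _] := pm t y t0 ty y1.
set V := `[x, s] `*` `[0, 1] in mx; set H := `[0, 1] `*` `[t, y] in my.
have mV : measurable (V : set (plane R)) by exact: measurable_rect.
have mH : measurable (H : set (plane R)) by exact: measurable_rect.
have sub : corner x y `<=` V `|` (H `|` corner x' y').
  move=> p [] /=; rewrite !in_itv /= => /andP[p1 p2] /andP[p3 p4].
  have [ps|sp] := leP p.1 s.
    by left; rewrite /V /=; split; rewrite /= in_itv /=; apply/andP; split; lra.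
  right; have [pt|pt] := leP t p.2.
    by left; rewrite /H /=; split; rewrite /= in_itv /=; apply/andP; split; lra.
  right; split; rewrite /= in_itv /=; apply/andP; split=> //.
    by move: sp; rewrite /s gt_min => /orP[/ltW//|]; lra.
  by move: pt; rewrite /t lt_max => /orP[/ltW//|]; lra.
have mC := measurable_corner x y; have mC' := measurable_corner x' y'.
have mHC := measurableU _ _ mH mC'.
have : (mu (corner x y) <= mu V + (mu H + mu (corner x' y')))%E.
  apply: le_trans (le_measure mu (mem_set mC) (mem_set (measurableU _ _ mV mHC)) sub) _.
  apply: le_trans (measureU2 mu mV mHC) _.
  by apply: leeD => //; exact: measureU2.
rewrite mx my.
rewrite -[mu (corner x y)]fineK ?fin_num_measure //.
rewrite -[mu (corner x' y')]fineK ?fin_num_measure //.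
rewrite -!EFinD lee_fin /=; lra.
Qed.

Lemma corner_mono (R : realType) (mu : probability (plane R) R) (x x' y y' : R) :
  x <= x' -> y' <= y -> fine (mu (corner x' y')) <= fine (mu (corner x y)).
Proof.
move=> xx yy; apply: fine_le; rewrite ?fin_num_measure //; try exact: measurable_corner.
apply: le_measure; rewrite ?inE; try exact: measurable_corner.
move=> p [] /=; rewrite !in_itv /= => /andP[p1 p2] /andP[p3 p4].
by split; rewrite /= in_itv /=; apply/andP; split=> //; lra.
Qed.

Lemma permuton_height_lipschitz (R : realType) (mu : probability (plane R) R) (y a b : R) :
  is_permuton mu -> y \in `[0, 1] -> a \in `[0, 1] -> b \in `[0, 1] ->
  `|permuton_height mu a y - permuton_height mu b y| <= `|a - b|.
Proof.
move=> pm y01 a01 b01; rewrite -[leRHS]mul1r.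
move: a b a01 b01; apply: dist_le_of_homo => a b a01 b01 ab; rewrite mul1r.
have := @corner_lipschitz R mu a b y y pm _ _ ab (lexx y).
move: y01 a01; rewrite !in_itv /= => -> -> /(_ isT isT).
have := corner_mono mu ab (lexx y); rewrite /permuton_height /corner => h1 h2.
by rewrite ler_norml; apply/andP; split; lra.
Qed.

(** For [e > 0], equal to 1 on the quadrant right of [x] and below [y], and to 0 outside the
    quadrant enlarged by [e]. *)
Definition ramp (R : realType) (e x y : R) (p : R * R) : R :=
  Num.max 0 (Num.min 1 (1 + Num.min (p.1 - x) (y - p.2) / e)).

Lemma continuous_ramp (R : realType) (e x y : R) : continuous (ramp e x y).
Proof.
move=> p; rewrite /continuous_at /ramp; apply: cvg_maxr; first exact: cvg_cst.
apply: cvg_minr; first exact: cvg_cst.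
apply: cvgD; first exact: cvg_cst.
apply: cvgM; last exact: cvg_cst.
apply: cvg_minr; apply: cvgB; try exact: cvg_cst; [exact: cvg_fst|exact: cvg_snd].
Qed.

Lemma measurable_ramp (R : realType) (e x y : R) (D : set (plane R)) :
  measurable_fun D (ramp e x y : plane R -> R).
Proof.
apply: (@measurable_funTS _ _ _ _ D).
apply: measurable_maxr; first exact: measurable_cst.
apply: measurable_minr; first exact: measurable_cst.
apply: measurable_funD; first exact: measurable_cst.
apply: measurable_funM; last exact: measurable_cst.
apply: measurable_minr; apply: measurable_funB; try exact: measurable_cst.
  exact: measurable_fst.
exact: measurable_snd.
Qed.

(** On the square the ramp lies between the indicators of the two corners. The side conditions keep
    the smaller corner inside the square; the larger one is clipped to it. *)
Lemma ramp_integral_bounds (R : realType) (nu : {measure set (plane R) -> \bar R})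
    (e x y : R) : 0 < e -> 0 <= x + e -> y - e <= 1 ->
  (nu (unit_square R) < +oo)%E ->
  fine (nu (corner (x + e) (y - e))) <=
    \int[nu]_(p in unit_square R) ramp e (x + e) (y - e) p <=
  fine (nu (corner (Num.max 0 x) (Num.min 1 y))).
Proof.
move=> e0 xe ye nuoo.
have mU : measurable (unit_square R : set (plane R)) by exact: measurable_rect.
have r0 p : 0 <= ramp e (x + e) (y - e) p by rewrite /ramp le_max lexx.
have r1 p : ramp e (x + e) (y - e) p <= 1 by rewrite /ramp ge_max ler01 ge_min lexx.
have sub1 : corner (x + e) (y - e) `<=` unit_square R.
  move=> p [] /=; rewrite !in_itv /= => /andP[p1 p2] /andP[p3 p4].
  by split; rewrite /= in_itv /=; apply/andP; split=> //; lra.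
have sub2 : corner (Num.max 0 x) (Num.min 1 y) `<=` unit_square R.
  move=> p [] /=; rewrite !in_itv /= ge_max le_min => /andP[/andP[p1 p1'] p2] /andP[p3 /andP[p4 p4']].
  by split; rewrite /= in_itv /=; apply/andP; split.
have fin A : measurable (A : set (plane R)) -> A `<=` unit_square R -> nu A \is a fin_num.
  move=> mA AU; rewrite ge0_fin_numE //; apply: le_lt_trans nuoo.
  by apply: le_measure; rewrite ?inE.
have I A : measurable (A : set (plane R)) -> A `<=` unit_square R ->
    nu A = (\int[nu]_(p in unit_square R) (\1_A p)%:E)%E.
  by move=> mA AU; rewrite integral_indic // setIidl.
have mr : measurable_fun (unit_square R : set (plane R)) (fun p => (ramp e (x + e) (y - e) p)%:E).
  by apply/measurable_EFinP; exact: measurable_ramp.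
have le1 : (nu (corner (x + e) (y - e)) <=
   \int[nu]_(p in unit_square R) (ramp e (x + e) (y - e) p)%:E)%E.
  rewrite I //; last exact: measurable_corner.
  apply: ge0_le_integral => //.
  - by apply/measurable_EFinP; apply: measurable_indic; exact: measurable_corner.
  - move=> p _; rewrite lee_fin indicE; case: (boolP (p \in _)) => [|_]; last exact: r0.
    rewrite inE => -[] /=; rewrite !in_itv /= => /andP[p1 _] /andP[_ p4].
    rewrite /ramp le_max le_min lexx lerDl divr_ge0 ?(ltW e0) ?orbT // le_min.
    by apply/andP; split; lra.
have le2 : (\int[nu]_(p in unit_square R) (ramp e (x + e) (y - e) p)%:E <=
   nu (corner (Num.max 0 x)%R (Num.min 1 y)%R))%E.
  rewrite [leRHS]I //; last exact: measurable_corner.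
  apply: ge0_le_integral => //.
  - by move=> p _; rewrite lee_fin.
  - by apply/measurable_EFinP; apply: measurable_indic; exact: measurable_corner.
  - move=> p [] /=; rewrite !in_itv /= => /andP[p1 p2] /andP[p3 p4].
    rewrite lee_fin indicE; case: (boolP (p \in _)) => [_|/negP h]; first exact: r1.
    rewrite /ramp ge_max lexx ge_min /=; apply/orP; right.
    have [h1|h1] := leP x p.1.
      have h2 : y < p.2.
        rewrite ltNge; apply/negP => h2; apply: h; rewrite inE; split.
          by rewrite /= in_itv /= ge_max p1 h1.
        by rewrite /= in_itv /= le_min p3 p4.
      rewrite -lerBrDl sub0r ler_pdivrMr // ge_min; apply/orP; right; lra.
    rewrite -lerBrDl sub0r ler_pdivrMr // ge_min; apply/orP; left; lra.
have fI : (\int[nu]_(p in unit_square R) (ramp e (x + e) (y - e) p)%:E)%E \is a fin_num.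
  rewrite ge0_fin_numE; last by apply: integral_ge0 => p _; rewrite lee_fin.
  apply: le_lt_trans le2 _; rewrite -ge0_fin_numE //.
  by apply: fin => //; exact: measurable_corner.
rewrite /Rintegral; apply/andP; split; apply: fine_le => //.
  by apply: fin => //; exact: measurable_corner.
by apply: fin => //; exact: measurable_corner.
Qed.

Lemma perm_permuton_finite (R : realType) n (u : 'S_n) :
  (perm_permuton R u (unit_square R) < +oo)%E.
Proof.
case: n u => [|n] u; first by rewrite perm_permutonE mul0e.
exact: le_lt_trans (height_perm_le u 0 1 isT) (ltry _).
Qed.

Lemma height_cvg_of_weak (R : realType) (v : forall n, 'S_n)
    (mu : probability (plane R) R) (x y : R) :
  is_permuton mu -> weakly_converges (fun n => perm_permuton R (v n)) mu ->
  x \in `[0, 1] -> y \in `[0, 1] ->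
  permuton_height (perm_permuton R (v n)) x y @[n --> \oo] --> permuton_height mu x y.
Proof.
move=> pm vmu; rewrite !in_itv /= => /andP[x0 x1] /andP[y0 y1].
(* Each side of the sandwich loses [d] to weak convergence and at most [2 * d] to the shift of the
   corner in both coordinates. *)
apply/cvgrPdist_le => e e0; pose d := e / 4.
have d0 : 0 < d by rewrite divr_gt0.
have muoo : (mu (unit_square R) < +oo)%E.
  by rewrite -ge0_fin_numE // fin_num_measure //; exact: measurable_rect.
have vr a b := vmu (ramp d a b) (continuous_subspaceT (@continuous_ramp R d a b)).
have [x0' y1' xd yd] : [/\ 0 <= x - d + d, y + d - d <= 1, 0 <= x + d & y - d <= 1].
  by split; lra.
have [xd' yd' x01 y01] : [/\ x <= x + d, y - d <= y, 0 <= x <= 1 & 0 <= y <= 1].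
  by split; lra.
have c1 := corner_lipschitz pm x01 y01 xd' yd'.
pose s := Num.max 0 (x - d); pose t := Num.min 1 (y + d).
have [s0 sx xs] : [/\ 0 <= s, s <= x & x - d <= s].
  by rewrite /s !(le_max, ge_max) !lexx orbT x0 /=; split=> //; lra.
have [t1 yt ty] : [/\ t <= 1, y <= t & t <= y + d].
  by rewrite /t !(le_min, ge_min) !lexx orbT y1 /=; split=> //; lra.
have [s01 t01] : 0 <= s <= 1 /\ 0 <= t <= 1 by split; apply/andP; split; lra.
have c2 := corner_lipschitz pm s01 t01 sx yt.
near=> n.
have l1 : `|\int[mu]_(p in unit_square R) ramp d x y p -
   \int[perm_permuton R (v n)]_(p in unit_square R) ramp d x y p| <= d.
  by near: n; apply: cvgr_dist_le (vr x y) _ d0.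
have l2 : `|\int[mu]_(p in unit_square R) ramp d (x + d) (y - d) p -
   \int[perm_permuton R (v n)]_(p in unit_square R) ramp d (x + d) (y - d) p| <= d.
  by near: n; apply: cvgr_dist_le (vr (x + d) (y - d)) _ d0.
have /andP[a1 _] := @ramp_integral_bounds R (perm_permuton R (v n)) d (x - d) (y + d) d0 x0' y1' (perm_permuton_finite _ _).
have /andP[_ a2] := @ramp_integral_bounds R mu d (x - d) (y + d) d0 x0' y1' muoo.
have /andP[_ b1] := @ramp_integral_bounds R (perm_permuton R (v n)) d x y d0 xd yd (perm_permuton_finite _ _).
have /andP[b2 _] := @ramp_integral_bounds R mu d x y d0 xd yd muoo.
move: a1 a2; rewrite subrK addrK => a1 a2.
move: b1; rewrite (max_r x0) (min_r y1) => b1.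
move: a2; rewrite -/s -/t => a2.
move: l1 l2; rewrite !ler_norml => /andP[l1 l1'] /andP[l2 l2'].
rewrite /permuton_height -/(corner x y).
have de : e = 4 * d by rewrite /d; field.
by apply/andP; split; rewrite de; clear -a1 a2 b1 b2 c1 c2 l1 l1' l2 l2' xs ty; lra.
Unshelve. all: by end_near. Qed.

(** * Concentration for uniform permutations *)

Definition perms_into n (B J : {set 'I_n}) : {set 'S_n} :=
  [set u : 'S_n | J \subset u @^-1: B]%SET.

(** Precomposition with the transposition of [x] and [y], which fixes [J] pointwise, exchanges the
    two sets. *)
Lemma perms_into_swap n (B J : {set 'I_n}) (x y : 'I_n) :
  x \notin J -> y \notin J ->
  #|perms_into B (x |: J)| = #|perms_into B (y |: J)|.
Proof.
move=> xJ yJ; rewrite -!sum1_card.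
rewrite (reindex_inj (mulgI (tperm x y))) /=; apply: eq_bigl => u.
rewrite !inE !finset.subUset !finset.sub1set !inE permM tpermL; congr andb.
apply/fintype.subsetP/fintype.subsetP => h i iJ; have := h i iJ; rewrite !inE permM tpermD //.
- by apply: contraNneq xJ => ->.
- by apply: contraNneq yJ => ->.
- by apply: contraNneq xJ => ->.
- by apply: contraNneq yJ => ->.
Qed.

(* Double counting of the pairs (u, y) with y outside J and u (y |: J) in B; by
   symmetry each y contributes the same number of permutations. *)
Lemma card_perms_into_setU1 n (B J : {set 'I_n}) (x : 'I_n) : x \notin J ->
  ((n - #|J|) * #|perms_into B (x |: J)| = #|perms_into B J| * (#|B| - #|J|))%N.
Proof.
move=> xJ.
transitivity (\sum_(y in ~: J) #|perms_into B (y |: J)|)%N.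
  rewrite (eq_bigr (fun=> #|perms_into B (x |: J)|)).
    by rewrite sum_nat_const [#|~: J|]cardsCs finset.setCK card_ord.
  by move=> y; rewrite inE => yJ; exact: perms_into_swap.
under eq_bigr do rewrite -sum1_card.
rewrite (exchange_big_dep (mem (perms_into B J))) /=; last first.
  by move=> y u _; rewrite !inE finset.subUset => /andP[].
rewrite -sum_nat_const; apply: eq_bigr => u; rewrite inE => Ju.
have cB : #|u @^-1: B| = #|B| by apply: on_card_preimset; apply: onW_bij; exact: injF_bij (@perm_inj _ u).
rewrite sum1_card -[in RHS]cB.
have -> : (#|u @^-1: B| - #|J| = #|u @^-1: B :\: J|)%N by rewrite cardsDS.
apply: eq_card => y; rewrite [LHS]unfold_in /= !inE finset.subUset finset.sub1set !inE Ju andbT.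
by rewrite andbC.
Qed.

(** Adding a point to a set of size [k] multiplies the probability by [(#|B| - k) / (n - k)], which
    is at most [#|B| / n]. *)
Lemma card_perms_into n (B J : {set 'I_n}) :
  (#|perms_into B J| * n ^ #|J| <= n`! * #|B| ^ #|J|)%N.
Proof.
move: {2}#|J| (erefl #|J|) => k; elim: k J => [|k IH] J Jk.
  by rewrite Jk !muln1 -card_Sn; exact: max_card.
have /card_gt0P [x xJ] : (0 < #|J|)%N by rewrite Jk.
have xJ' : x \notin J :\ x by rewrite !inE eqxx.
have Jk' : #|J :\ x| = k by move: Jk; rewrite (cardsD1 x) xJ => -[].
have := card_perms_into_setU1 B xJ'; rewrite finset.setD1K // Jk'.
have := IH _ Jk'; rewrite Jk' Jk.
have kn : (k < n)%N by rewrite -Jk -[X in (_ <= X)%N]card_ord; exact: max_card.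
have bn : (#|B| <= n)%N by rewrite -[X in (_ <= X)%N]card_ord; exact: max_card.
rewrite !expnS; move: #|_| #|perms_into B _| #|B| bn (n ^ k)%N => N1 N0 b bn nk.
move: (b ^ k)%N (n`!)%N => bk nf h e.
have h1 : ((b - k) * n <= b * (n - k))%N.
  have [bk'|kb] := leqP b k; first by rewrite (eqP bk') mul0n.
  rewrite mulnBl mulnBr; apply: leq_sub2l; rewrite mulnC; exact: leq_mul.
have h2 : (N1 * n <= N0 * b)%N.
  rewrite -(@leq_pmul2l (n - k)) ?subn_gt0 //.
  by rewrite mulnA e; nia.
by nia.
Qed.

(* Expanding the product over the subsets J of A reduces the bound to
   P (u J in B) <= (#|B| / n) ^ #|J|. *)
Lemma perms_mgf_le (R : realType) n (A B : {set 'I_n}) (t : R) : (0 < n)%N ->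
  0 <= t ->
  \sum_(u : 'S_n) \prod_(i in A) (1 + t * (u i \in B)%:R) <=
  n`!%:R * (1 + t * (#|B|%:R / n%:R)) ^+ #|A|.
Proof.
move=> n0 t0; set p : R := _ / _.
have p0 : 0 <= p by rewrite divr_ge0.
(* With the indicator of [A] in the coefficient, the expansion can run over all subsets [J]; those
   not inside [A] contribute 0. *)
pose c (i : 'I_n) : R := t * (i \in A)%:R.
have c0 i : 0 <= c i by rewrite mulr_ge0.
have expand (w : 'I_n -> R) : \prod_(i in A) (1 + t * w i) =
    \sum_(J : {set 'I_n}) (\prod_(i in J) c i) * \prod_(i in J) w i.
  rewrite big_mkcond /= (eq_bigr (fun i => c i * w i + 1)).
    rewrite bigA_distr; apply: eq_bigr => J _.
    by rewrite -big_split /= -big_mkcond.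
  by move=> i _; rewrite /c; case: (i \in A); rewrite ?mulr1 ?mulr0 ?mul0r ?add0r // addrC.
have -> : (1 + t * p) ^+ #|A| = \prod_(i in A) (1 + t * p) by rewrite prodr_const.
rewrite (expand (fun=> p)).
rewrite (eq_bigr (fun u : 'S_n => \sum_(J : {set 'I_n}) (\prod_(i in J) c i) *
  \prod_(i in J) (u i \in B)%:R)); last by move=> u _; exact: expand.
rewrite exchange_big mulr_sumr /=; apply: ler_sum => J _.
rewrite -mulr_sumr mulrCA; apply: ler_wpM2l; first by apply: prodr_ge0 => i _.
have -> : \sum_(u : 'S_n) \prod_(i in J) (u i \in B)%:R = #|perms_into B J|%:R :> R.
  rewrite -sum1_card natr_sum [RHS]big_mkcond /=; apply: eq_bigr => u _.
  rewrite inE; case: ifPn => [/fintype.subsetP h|/subsetPn[i iJ iB]].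
    by rewrite big1 // => i /h; rewrite inE => ->.
  by rewrite (bigD1 i) //=; move: iB; rewrite inE => /negbTE ->; rewrite mul0r.
rewrite prodr_const /p expr_div_n mulrA ler_pdivlMr ?exprn_gt0 ?ltr0n //.
by rewrite -!natrX -!natrM ler_nat card_perms_into.
Qed.

(** From [1 - l <= expR (- l)] one gets [(1 - l) * expR l <= 1], and [1 - l] times the right-hand
    side is at least 1. *)
Lemma expR_le_quadratic (R : realType) (l : R) : 0 <= l <= 1 / 2 ->
  expR l <= 1 + l + 2 * l ^+ 2.
Proof.
move=> /andP[l0 l1]; have h : 1 - l <= expR (- l) by exact: expR_ge1Dx.
have e0 := expR_gt0 l; have e1 : expR (- l) * expR l = 1 by rewrite -expRD addNr expR0.
have e2 : (1 - l) * expR l <= 1 by rewrite -[leRHS]e1 ler_wpM2r // ltW.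
have l3 : 0 < 1 - l by lra.
have l4 : 1 <= (1 - l) * (1 + l + 2 * l ^+ 2).
  rewrite [leRHS](_ : _ = 1 + l ^+ 2 * (1 - 2 * l)); last by ring.
  by rewrite lerDl mulr_ge0 ?exprn_ge0 //; lra.
by rewrite -(ler_pM2l l3); exact: le_trans l4.
Qed.

Definition hits n (A B : {set 'I_n}) (u : 'S_n) : nat :=
  (\sum_(i in A) (u i \in B))%N.

(* Markov's inequality for expR (l * hits) with l = e / 4. *)
Lemma hits_tail (R : realType) n (A B : {set 'I_n}) (e : R) : (0 < n)%N ->
  0 < e <= 1 ->
  #|[set u : 'S_n | #|A|%:R * (#|B|%:R / n%:R) + n%:R * e <= (hits A B u)%:R :> R]%SET|%:R
    <= n`!%:R * expR (- (e ^+ 2 / 8)) ^+ n :> R.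
Proof.
move=> n0 /andP[e0 e1]; set p : R := #|B|%:R / n%:R; set S := [set u | _]%SET.
(* This [l] minimizes [2 * l ^+ 2 - l * e], the exponent per unit of [n], with minimum
   [- (e ^+ 2 / 8)]. *)
pose l := e / 4; have n0R : 0 < n%:R :> R by rewrite ltr0n.
have p0 : 0 <= p by rewrite divr_ge0.
have p1 : p <= 1.
  by rewrite ler_pdivrMr // mul1r ler_nat -[X in (_ <= X)%N]card_ord max_card.
have A0 : 0 <= #|A|%:R :> R by [].
have An : #|A|%:R <= n%:R :> R.
  by rewrite ler_nat -[X in (_ <= X)%N]card_ord max_card.
have l0 : 0 < l by rewrite divr_gt0.
have l2 : 0 <= l <= 1 / 2 by rewrite /l; apply/andP; split; lra.
have mgf : \sum_(u : 'S_n) expR (l * (hits A B u)%:R) <=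
    n`!%:R * expR ((l + 2 * l ^+ 2) * p * #|A|%:R).
  have t0 : 0 <= expR l - 1 by rewrite subr_ge0 -expR0 ler_expR ltW.
  have -> : \sum_(u : 'S_n) expR (l * (hits A B u)%:R) =
      \sum_(u : 'S_n) \prod_(i in A) (1 + (expR l - 1) * (u i \in B)%:R).
    apply: eq_bigr => u _; rewrite /hits natr_sum mulr_sumr expR_sum.
    apply: eq_bigr => i _; case: (u i \in B); rewrite ?mulr1 ?mulr0 ?expR0 ?addr0 //.
    by rewrite addrC subrK.
  apply: le_trans (perms_mgf_le A B n0 t0) _; rewrite -/p.
  rewrite ler_wpM2l // expRM_natr; apply: lerXn2r; rewrite ?nnegrE ?expR_ge0 //.
    by rewrite addr_ge0 // mulr_ge0.
  apply: le_trans (expR_ge1Dx _); rewrite lerD2l ler_wpM2r //.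
  by have := expR_le_quadratic l2; lra.
have : \sum_(u in S) expR (l * (#|A|%:R * p + n%:R * e)) <=
    n`!%:R * expR ((l + 2 * l ^+ 2) * p * #|A|%:R).
  apply: le_trans mgf; rewrite [leRHS](bigID (mem S)) /=.
  apply: ler_wpDr; first by apply: sumr_ge0 => u _; exact: expR_ge0.
  by apply: ler_sum => u; rewrite inE => uS; rewrite ler_expR ler_wpM2l // ltW.
rewrite sumr_const -[_ *+ #|_|]mulr_natl -ler_pdivlMr ?expR_gt0 // => h.
apply: le_trans h _; rewrite -(mulrA n`!%:R) -expRN -expRD -expRM_natr ler_wpM2l // ler_expR.
have pA : p * #|A|%:R <= n%:R by rewrite -[leRHS]mul1r; apply: ler_pM.
have pA0 : 0 <= p * #|A|%:R by rewrite mulr_ge0.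
have -> : (l + 2 * l ^+ 2) * p * #|A|%:R + - (l * (#|A|%:R * p + n%:R * e)) =
    e ^+ 2 / 8 * (p * #|A|%:R) - e ^+ 2 / 4 * n%:R by rewrite /l; field.
have : e ^+ 2 / 8 * (p * #|A|%:R) <= e ^+ 2 / 8 * n%:R.
  by rewrite ler_wpM2l // divr_ge0 // exprn_ge0 // ltW.
by lra.
Qed.

(** The lower tail is the upper tail for the complement of [B], because the hits of [B] and of its
    complement add up to [#|A|]; the union of the two gives the factor 2. *)
Lemma rk_tail (R : realType) n i j (e : R) : (0 < n)%N -> (i <= n)%N -> (j <= n)%N ->
  0 < e <= 1 ->
  #|[set u : 'S_n | n%:R * e <= `|(rk u i j)%:R - (n - i)%:R * (j%:R / n%:R)| :> R]%SET|%:R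
    <= 2 * (n`!%:R * expR (- (e ^+ 2 / 8)) ^+ n) :> R.
Proof.
move=> n0 i_n jn e01; have n0R : 0 < n%:R :> R by rewrite ltr0n.
pose A : {set 'I_n} := [set k : 'I_n | (i <= k)%N]%SET.
pose B : {set 'I_n} := [set k : 'I_n | (k < j)%N]%SET.
have hB u : hits A B u = rk u i j.
  rewrite /hits big_mkcond /=; apply: eq_bigr => k _.
  by rewrite !inE; case: (i <= k)%N.
have cB : #|B| = j.
  rewrite -[RHS](rk0 (1%g : 'S_n) jn) /rk -sum1_card big_mkcond /=.
  by apply: eq_bigr => k _; rewrite inE perm1; case: (k < j)%N.
have cBC : (#|~: B| = n - j)%N by rewrite -cB -[X in (X - _)%N]card_ord -(cardsC B) addKn.
have hA u : (hits A B u + hits A (~: B) u = #|A|)%N.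
  rewrite /hits -big_split -sum1_card /=; apply: eq_bigr => k _.
  by rewrite [in X in (_ + X)%N]inE; case: (_ \in B).
have cA : #|A| = (n - i)%N.
  suff h : #|~: A| = i by have := cardsC A; rewrite card_ord h; lia.
  rewrite -[RHS](rk0 (1%g : 'S_n) i_n) /rk -sum1_card big_mkcond /=.
  by apply: eq_bigr => k _; rewrite !inE perm1 -ltnNge; case: (k < i)%N.
have S1 := @hits_tail R n A B e n0 e01; have S2 := @hits_tail R n A (~: B) e n0 e01.
set S := [set u | _]%SET; set T1 := [set u | _]%SET in S1; set T2 := [set u | _]%SET in S2.
have ST : S \subset T1 :|: T2.
  apply/fintype.subsetP => u; rewrite !inE cA cB cBC ler_normr => /orP[h|h]; apply/orP.
    by left; rewrite hB; lra.
  right; have := hA u; rewrite hB cA => /(congr1 (fun k => k%:R : R)); rewrite natrD => hu.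
  have : (n - i)%:R * ((n - j)%:R / n%:R) = (n - i)%:R - (n - i)%:R * (j%:R / n%:R) :> R.
    by rewrite (natrB _ jn); field; rewrite gt_eqF.
  by move=> ->; lra.
apply: le_trans (_ : (#|T1| + #|T2|)%:R <= _); last by rewrite natrD; lra.
rewrite ler_nat; apply: leq_trans (subset_leq_card ST) _.
by rewrite cardsU leq_subr.
Qed.

(** The geometric bounds are summable, so the limit superior of the events is a null set. *)
Lemma borel_cantelli_ae d (T : measurableType d) (R : realType)
    (P : probability T R) (E : nat -> set T) (c q : R) :
  0 <= q < 1 -> (forall n, measurable (E n)) ->
  (forall n, (P (E n) <= (c * q ^+ n)%:E)%E) ->
  {ae P, forall w, \forall n \near \oo, ~ E n w}.
Proof.
move=> /andP[q0 q1] mE PE.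
exists (lim_sup_set E); split.
- by apply: bigcap_measurable => // n _; exact: bigcup_measurable.
- apply: lim_sup_set_cvg0 => //.
  apply: (@le_lt_trans _ _ (c / (1 - q))%:E); last exact: ltry.
  apply: lime_le; first exact: is_cvg_nneseries.
  apply: nearW => n; apply: (@le_trans _ _ (\sum_(0 <= k < n) (c * q ^+ k)%:E)%E).
    by apply: lee_sum => k _; exact: PE.
  rewrite sumEFin lee_fin -mulr_sumr.
  have c0 : 0 <= c.
    by have := le_trans (measure_ge0 P (E 0%N)) (PE 0%N); rewrite lee_fin expr0 mulr1.
  apply: ler_wpM2l => //.
  have q1' : 0 < 1 - q by rewrite subr_gt0.
  rewrite -[leRHS]mul1r ler_pdivlMr // big_mkord.
  have := subrX1 q n; rewrite -[X in _ = X * _]opprB mulNr => h.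
  by rewrite mulrC; have := exprn_ge0 n q0; lra.
- move=> w /= nw N _; apply: contrapT => h; apply: nw; exists N => // n Nn En.
  by apply: h; exists n.
Qed.

(** * Almost sure convergence of the rows of uniform permutations *)

Section Random.
Context d (Omega : measurableType d) (R : realType) (P : probability Omega R).
Variable v : forall n, Omega -> 'S_n.
Hypothesis hv : random_permutations v.
Hypothesis uv : uniformly_distributed P v.

Lemma uniform_prob_le n (S : {set 'S_n}) :
  measurable [set w | v n w \in S] /\
  (P [set w | v n w \in S] <= (#|S|%:R / n`!%:R)%:E)%E.
Proof.
have -> : [set w | v n w \in S] = \big[setU/set0]_(s in S) [set w | v n w = s].
  apply/seteqP; split => w /=.
    by move=> vS; rewrite (bigD1 (v n w)) //; left.
  by elim/big_ind : _ => // [A B hA hB [/hA|/hB] //|s sS /= ->].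
split; first by apply: bigsetU_measurable => s _; exact: hv.
apply: le_trans (measure_bigsetU_le _ _ _) _; first by move=> s; exact: hv.
rewrite (eq_bigr (fun=> (n`!%:R^-1)%:E)); last by move=> s _; exact: uv.
by rewrite sumEFin sumr_const mulr_natl.
Qed.

Lemma ae_rk_deviation (x y e : R) : x \in `[0, 1] -> y \in `[0, 1] -> 0 < e <= 1 ->
  {ae P, forall w, \forall n \near \oo,
    ~ (n%:R * e <= `|(rk (v n w) (Num.truncn (n%:R * x)) (Num.truncn (n%:R * y)))%:R -
       (n - Num.truncn (n%:R * x))%:R * ((Num.truncn (n%:R * y))%:R / n%:R)|)}.
Proof.
move=> x01 y01 e01.
pose S n : {set 'S_n} := [set u : 'S_n | n%:R * e <= `|(rk u (Num.truncn (n%:R * x)) (Num.truncn (n%:R * y)))%:R -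
       (n - Num.truncn (n%:R * x))%:R * ((Num.truncn (n%:R * y))%:R / n%:R)|]%SET.
have := @borel_cantelli_ae _ Omega R P (fun n => [set w | v n w \in S n]) 2 (expR (- (e ^+ 2 / 8))).
have q1 : 0 <= expR (- (e ^+ 2 / 8)) < 1.
  rewrite expR_ge0 expR_lt1 oppr_lt0 divr_gt0 // exprn_gt0 //.
  by case/andP: e01.
move=> /(_ q1 (fun n => (uniform_prob_le (S n)).1)).
have PS n : (P [set w | v n w \in S n] <= (2 * expR (- (e ^+ 2 / 8)) ^+ n)%:E)%E.
  (* For [n = 0] the bound is 2, so it holds for any probability. *)
  have [->|n0] := posnP n.
    by apply: le_trans (probability_le1 _ _) _; [exact: (uniform_prob_le _).1|rewrite lee_fin expr0; lra].
  apply: le_trans (uniform_prob_le _).2 _.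
  rewrite lee_fin ler_pdivrMr ?ltr0n ?fact_gt0 //.
  have := @rk_tail R n _ _ e n0 (truncn_mul_le n x01) (truncn_mul_le n y01) e01.
  by move=> h; apply: le_trans h _; lra.
move=> /(_ PS); apply: filterS => w; apply: filterS => n nS h; apply: nS.
by rewrite /= inE.
Qed.

(** Only the countably many thresholds [M.+1%:R^-1] are used, so the exceptional sets have a null
    union. *)
Lemma ae_rk_cvg (x y : R) : x \in `[0, 1] -> y \in `[0, 1] ->
  {ae P, forall w,
    (rk (v n w) (Num.truncn (n%:R * x)) (Num.truncn (n%:R * y)))%:R / n%:R
      @[n --> \oo] --> (1 - x) * y}.
Proof.
move=> x01 y01.
have x0 : 0 <= x by move: x01; rewrite in_itv /= => /andP[].
have y0 : 0 <= y by move: y01; rewrite in_itv /= => /andP[].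
have : {ae P, forall w, forall M, \forall n \near \oo,
    ~ (n%:R * M.+1%:R^-1 <= `|(rk (v n w) (Num.truncn (n%:R * x)) (Num.truncn (n%:R * y)))%:R -
       (n - Num.truncn (n%:R * x))%:R * ((Num.truncn (n%:R * y))%:R / n%:R)| :> R)}.
  apply: ae_foralln => M; apply: ae_rk_deviation => //.
  by rewrite invr_gt0 ltr0n /= invf_le1 ?ltr0n // ler1n.
apply: filterS => w dev; apply/cvgrPdist_le => e e0.
have e2 : 0 < e / 2 by rewrite divr_gt0.
pose M := Num.truncn (e / 2)^-1.
have Me : M.+1%:R^-1 <= e / 2.
  by rewrite -[e / 2]invrK lef_pV2 ?posrE ?invr_gt0 ?ltr0n // ltW // truncnS_gt.
have cx : (1 - (Num.truncn (n%:R * x))%:R / n%:R) * ((Num.truncn (n%:R * y))%:R / n%:R)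
    @[n --> \oo] --> (1 - x) * y.
  apply: cvgM; last exact: cvg_truncn_div.
  by apply: cvgB; [exact: cvg_cst|exact: cvg_truncn_div].
near=> n.
have n0 : (0 < n)%N by near: n; exists 1%N.
have n0R : 0 < n%:R :> R by rewrite ltr0n.
have h1 : `|(1 - x) * y - (1 - (Num.truncn (n%:R * x))%:R / n%:R) *
    ((Num.truncn (n%:R * y))%:R / n%:R)| <= e / 2.
  by near: n; apply: cvgr_dist_le cx _ e2.
have : ~ (n%:R * M.+1%:R^-1 <= `|(rk (v n w) (Num.truncn (n%:R * x)) (Num.truncn (n%:R * y)))%:R -
       (n - Num.truncn (n%:R * x))%:R * ((Num.truncn (n%:R * y))%:R / n%:R)| :> R).
  by near: n; exact: dev.
move=> /negP; rewrite -ltNge natrB ?truncn_mul_le // => h2.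
set r := (rk _ _ _)%:R in h2 *; set a := (Num.truncn (n%:R * x))%:R in h1 h2 *.
set b := (Num.truncn (n%:R * y))%:R / n%:R in h1 h2 *.
have h3 : `|(1 - a / n%:R) * b - r / n%:R| <= e / 2.
  rewrite -(ler_pM2l n0R) -[X in X * _ <= _]gtr0_norm // -normrM distrC in h2 *.
  rewrite (_ : n%:R * _ = (n%:R - a) * b - r); last by field; rewrite gt_eqF.
  apply: le_trans (ltW h2) _; first by rewrite ler_pM2l.
rewrite (_ : (1 - x) * y - r / n%:R = ((1 - x) * y - (1 - a / n%:R) * b) + ((1 - a / n%:R) * b - r / n%:R)); last by ring.
by apply: le_trans (ler_normD _ _) _; lra.
Unshelve. all: by end_near. Qed.

Lemma ae_rk_cvg_grid (y : R) : y \in `[0, 1] ->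
  {ae P, forall w, forall N k, (k <= N.+1)%N ->
    (rk (v n w) (Num.truncn (n%:R * (k%:R / N.+1%:R : R))) (Num.truncn (n%:R * y)))%:R / n%:R
      @[n --> \oo] --> (1 - k%:R / N.+1%:R) * y}.
Proof.
move=> y01; apply: ae_foralln => N; apply: ae_foralln => k.
have [kN|kN] := leqP k N.+1; last by apply: aeW.
have g01 : (k%:R / N.+1%:R : R) \in `[0, 1]%R.
  by rewrite in_itv /= divr_ge0 //= ler_pdivrMr ?ltr0n // mul1r ler_nat.
by apply: filterS (ae_rk_cvg g01 y01) => w h _.
Qed.

End Random.

(** * Almost sure limits for a general permuton and for uniform permutations *)

Theorem theorem1p4 (R : realType) (phi psi : R -> R)
  (hphi : boundary_function phi) (hpsi : boundary_function psi)
  (hle : forall z : R, z \in `[0, 1] -> phi z <= psi z)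
  (Lsw Lne : forall n, lattice_path n)
  (hsw : forall n, (0 < n)%N -> weakly_southwest R (Lsw n) (Lne n))
  (cvg_sw : forall z : R, z \in `[0, 1] ->
    path_theta (Lsw n) z @[n --> \oo] --> phi z)
  (cvg_ne : forall z : R, z \in `[0, 1] ->
    path_theta (Lne n) z @[n --> \oo] --> psi z)
  (ext : nat -> seq box)
  (hext : forall n, (0 < n)%N ->
    linear_extension (shape_between R (Lsw n) (Lne n)) (ext n))
  (d : measure_display) (Omega : measurableType d) (P : probability Omega R)
  (v u : forall n, Omega -> 'S_n)
  (hv : random_permutations v)
  (hu : forall n w, (0 < n)%N ->
    u n w = tau_word (map box_content (ext n)) (v n w)) :
  (forall mu : probability (plane R) R, is_permuton mu ->
    {ae P, forall w, weakly_converges (fun n => perm_permuton R (v n w)) mu} ->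
    forall x y : R, x \in `[0, 1] -> y \in `[0, 1] ->
    exists2 m, is_min_on_unit (fun g => permuton_height mu g y + h1 phi psi x g) m &
      {ae P, forall w,
        permuton_height (perm_permuton R (u n w)) x y @[n --> \oo] --> m}) /\
  (mutually_independent P v -> uniformly_distributed P v ->
    forall x y : R, x \in `[0, 1] -> y \in `[0, 1] ->
    exists2 m, is_min_on_unit (fun g => (1 - g) * y + h1 phi psi x g) m &
      {ae P, forall w,
        permuton_height (perm_permuton R (u n w)) x y @[n --> \oo] --> m}).
Proof.
(* [u n] is prescribed only for positive [n]; the index 0 does not affect the limit. *)
have to_u w (x y m : R) : permuton_height
      (perm_permuton R (tau_word (map box_content (ext n)) (v n w))) x y @[n --> \oo] --> m ->
    permuton_height (perm_permuton R (u n w)) x y @[n --> \oo] --> m.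
  move=> h; apply: cvg_of_dist_inv h => n n0.
  by rewrite (hu _ w n0) subrr normr0 invr_ge0.
split.
- move=> mu pm vmu x y x01 y01.
  have FL a b : a \in `[0, 1] -> b \in `[0, 1] ->
      `|permuton_height mu a y - permuton_height mu b y| <= `|a - b|.
    exact: permuton_height_lipschitz.
  have [m mm] := cost_attains_min psi cvg_sw FL x; exists m => //.
  apply: filterS vmu => w vw; apply: to_u.
  apply: (height_cvg hsw cvg_sw cvg_ne FL hext x01 y01 _ mm) => N k kN.
  have g01 : (k%:R / N.+1%:R : R) \in `[0, 1]%R.
    by rewrite in_itv /= divr_ge0 //= ler_pdivrMr ?ltr0n // mul1r ler_nat.
  apply: cvg_of_dist_inv (height_cvg_of_weak pm vw g01 y01) => n n0.
  exact: height_perm_rk.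
- move=> _ uv x y x01 y01.
  have FL a b : a \in `[0, 1] -> b \in `[0, 1] ->
      `|(1 - a) * y - (1 - b) * y| <= `|a - b|.
    move=> _ _; rewrite -mulrBl (_ : 1 - a - (1 - b) = b - a); last by ring.
    rewrite normrM distrC ler_piMr //.
    by move: y01; rewrite in_itv /= => /andP[y0 y1]; rewrite ger0_norm.
  have [m mm] := cost_attains_min psi cvg_sw FL x; exists m => //.
  apply: filterS (ae_rk_cvg_grid hv uv y01) => w vw; apply: to_u.
  exact: (height_cvg hsw cvg_sw cvg_ne FL hext x01 y01 vw mm).
Qed.
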